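(* Let $\Omega\subseteq\mathbb{R}^d$ be open, $p\in[1,\infty)$, $m\in\mathbb{N}$, $v\in\mathcal{C}^{m,*}(\Omega)\cap L^\infty(\Omega)$, and $s:\pi_m\to[0,\infty)$ an admissible map. Assume there is $C>0$ such that for all $n\ge1$, all $\sigma\in\pi_m^0$ and all $x\in M_n\setminus M_{2n}$, $|\partial^\sigma v(x)|\le Cn^{s(\sigma)-1}$. Then for every $f\in W^{m,p}_{s,v}(\Omega)$, each $\chi_nf$ belongs to $W^{m,p}(\Omega)$ and $\chi_nf\to f$ in $W^{m,p}_{s,v}(\Omega)$ as $n\to\infty$.
   Context: Throughout, $\Omega\subseteq\mathbb{R}^d$ is open, $\mathbb{N}=\{0,1,2,\dots\}$, $p\in[1,\infty)$, $K\Subset\Omega$ means $K$ compact in $\Omega$, $\pi_m=\{\alpha\in\mathbb{N}^d:|\alpha|\le m\}$, $\pi_m^0=\pi_m\setminus\{0\}$, $\beta\le\alpha$ componentwise. A weight is a locally integrable function positive a.e.; $E_p(\Omega)$ is the set of measurable $w$ with $|w|^p$ a weight. For measurable $u$, $L^p_u(\Omega)=\{f:fu\in L^p(\Omega)\}$ with norm $\|fu\|_{L^p}$; $L^p_{u,\mathrm{loc}}$: $fu\in L^p(K)$ for all $K\Subset\Omega$. $\mathcal{C}^{k,*}(\Omega)$: $v\in\mathcal{C}^k(\Omega)$ with $v\ne0$ a.e. Condition (H): for every $K\Subset\Omega$ there is $C>0$ with $|v|\le C|w|$ a.e. in $K$. Weak derivative $D^\alpha_v$ ($|\alpha|\ge1$,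 $w\in E_p(\Omega)$, $v\in\mathcal{C}^{|\alpha|,*}(\Omega)$ with (H) w.r.t. $w$): for $f\in L^1_{w,\mathrm{loc}}(\Omega)$, $D^\alpha_vf$ is the unique $g\in L^1_{v^{|\alpha|+1},\mathrm{loc}}(\Omega)$, if it exists, with $\int_\Omega f\,\partial^\alpha(v^{|\alpha|+1}\phi)\,dx=(-1)^{|\alpha|}\int_\Omega v^{|\alpha|+1}\phi\,g\,dx$ for all $\phi\in C_c^\infty(\Omega)$; $D^0_vf:=f$. $W^{m,p}_{V,v}(\Omega)$ for $V=\{w_\alpha\}_{\alpha\in\pi_m}\subset E_p(\Omega)$, $v\in\mathcal{C}^{m,*}(\Omega)$ with (H) w.r.t. $w_0$: all $f\in L^p_{w_0}(\Omega)$ with $D^\alpha_vf\in L^p_{w_\alpha}(\Omega)$ for $\alpha\in\pi_m^0$, norm $(\sum_{\alpha\in\pi_m}\|w_\alpha D^\alpha_vf\|_{L^p}^p)^{1/p}$. Admissible map: $s:\pi_m\to[0,\infty)$ with $s(\alpha)\le|\alpha|$ and $s(\alpha-\beta)+s(\beta)\le s(\alpha)$ for $\alpha\in\pi_m,\beta\le\alpha$. $W^{m,p}_{s,v}(\Omega):=W^{m,p}_{V,v}(\Omega)$ with $w_\alpha=|v|^{s(\alpha)+1}$. Cut-offs: fix $\eta\in\mathcal{C}^\infty(\mathbb{R})$ with $0\le\eta\le1$, $\eta\equiv1$ on $\mathbb{R}\setminus[-1,1]$, $\eta\equiv0$ on $[-\tfrac12,\tfrac12]$. For $n\ge1$, $\chi_n:=\eta(n\,v(\cdot))$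 and $M_n:=\{x\in\Omega:|v(x)|\le1/n\}$. *)

(* Defs.v *)
From HB Require Import structures.
From mathcomp Require Import all_boot all_order all_algebra.
From mathcomp Require Import all_classical all_reals all_analysis.
Set Implicit Arguments.
Unset Strict Implicit.
Unset Printing Implicit Defensive.
Import Order.TTheory GRing.Theory Num.Theory.
Import numFieldNormedType.Exports.
Local Open Scope classical_set_scope.
Local Open Scope ring_scope.

Section defs.
Variable R : realType.

(* Lebesgue integral on R^d of a nonnegative function, via Tonelli as the
   iterated one-dimensional Lebesgue integral x_1, ..., x_d.  For Borel
   measurable nonnegative functions this IS the d-dimensional Lebesgue
   integral. *)
Fixpoint intRd (d : nat) : ('rV[R]_d -> \bar R) -> \bar R :=
  match d with
  | 0 => fun f => f 0
  | d'.+1 => fun f =>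
      (\int[@lebesgue_measure R]_t
         intRd (fun y : 'rV[R]_d' => f (row_mx (t%:M : 'M[R]_1) y)))%E
  end.

Variable d : nat.
Local Notation Rd := ('rV[R]_d).

Definition borelRd (A : set Rd) : Prop := <<s [set B : set Rd | open B] >> A.
Definition measRd (g : Rd -> R) : Prop :=
  forall B : set R, measurable B -> borelRd (g @^-1` B).

Definition negligibleRd (A : set Rd) : Prop :=
  exists N, borelRd N /\ A `<=` N /\ intRd (fun x => (\1_N x)%:E) = 0%E.

Definition restr (Om : set Rd) (f : Rd -> R) : Rd -> R :=
  fun x => if x \in Om then f x else 0.

Definition intnn (A : set Rd) (g : Rd -> R) : \bar R :=
  intRd (fun x => (restr A g x)%:E).

Definition intO (A : set Rd) (g : Rd -> R) : \bar R :=
  (intnn A (fun x => Num.max (g x) 0%R) - intnn A (fun x => Num.max (- g x)%R 0%R))%E.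

Definition finite_int (X : \bar R) : Prop := (X < +oo)%E.

Definition Lpw (Om : set Rd) (p : R) (u f : Rd -> R) : Prop :=
  measRd (restr Om f) /\
  finite_int (intnn Om (fun x => powR `|f x * u x| p)).

Definition Lpw_loc (Om : set Rd) (p : R) (u f : Rd -> R) : Prop :=
  measRd (restr Om f) /\
  forall K : set Rd, compact K -> K `<=` Om ->
    finite_int (intnn K (fun x => powR `|f x * u x| p)).

Definition unitv (i : 'I_d) : Rd := delta_mx 0 i.
Definition pderiv (i : 'I_d) (g : Rd -> R) : Rd -> R :=
  fun x => 'D_(unitv i) g x.
Definition dlist (s : seq 'I_d) (g : Rd -> R) : Rd -> R := foldr pderiv g s.

Definition Ck (Om : set Rd) (k : nat) (g : Rd -> R) : Prop :=
  (forall s : seq 'I_d, (size s <= k)%N ->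
      forall x, Om x -> {for x, continuous (dlist s g)}) /\
  (forall s : seq 'I_d, (size s < k)%N ->
      forall i x, Om x -> derivable (dlist s g) x (unitv i)).

Definition Ckstar (Om : set Rd) (k : nat) (v : Rd -> R) : Prop :=
  Ck Om k v /\ negligibleRd [set x | Om x /\ v x = 0].

Definition Linfty (Om : set Rd) (v : Rd -> R) : Prop :=
  exists M : R, negligibleRd [set x | Om x /\ M < `|v x|].

Definition testfun (Om : set Rd) (phi : Rd -> R) : Prop :=
  (forall k, Ck setT k phi) /\
  exists K : set Rd, [/\ compact K, K `<=` Om & forall x, ~ K x -> phi x = 0].

Definition mi := {ffun 'I_d -> nat}.
Definition mabs (a : mi) : nat := (\sum_(i < d) a i)%N.
Definition mi_le (b a : mi) : Prop := forall i, (b i <= a i)%N.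
Definition mi_sub (a b : mi) : mi := [ffun i => (a i - b i)%N].
Definition mi0 : mi := [ffun => 0%N].
Definition mseq (a : mi) : seq 'I_d := flatten [seq nseq (a i) i | i <- enum 'I_d].
Definition dpart (a : mi) (g : Rd -> R) : Rd -> R := dlist (mseq a) g.

Definition mi_of (m : nat) (a : {ffun 'I_d -> 'I_m.+1}) : mi := [ffun i => val (a i)].
Definition sum_pi (m : nat) (F : mi -> \bar R) : \bar R :=
  (\sum_(a : {ffun 'I_d -> 'I_m.+1} | (mabs (mi_of a) <= m)%N) F (mi_of a))%E.

Definition admissible (m : nat) (s : mi -> R) : Prop :=
  forall a : mi, (mabs a <= m)%N ->
    [/\ 0 <= s a, s a <= (mabs a)%:R &
        forall b : mi, mi_le b a -> s (mi_sub a b) + s b <= s a].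

(* Weak derivative D^alpha_v (w is the weight w_0): g = D^alpha_v f *)
Definition wderiv_v (Om : set Rd) (w v : Rd -> R) (a : mi) (f g : Rd -> R) :
  Prop :=
  Lpw_loc Om 1 w f /\
  Lpw_loc Om 1 (fun x => v x ^+ (mabs a).+1) g /\
  forall phi, testfun Om phi ->
    intO Om (fun x => f x * dpart a (fun y => v y ^+ (mabs a).+1 * phi y) x)
    = (((-1) ^+ mabs a)%:E *
       intO Om (fun x => (v x ^+ (mabs a).+1 * phi x * g x)%R))%E.

Definition wsv (s : mi -> R) (v : Rd -> R) (a : mi) : Rd -> R :=
  fun x => powR `|v x| (s a + 1).

Definition Wsv (Om : set Rd) (m : nat) (p : R) (s : mi -> R) (v f : Rd -> R) :
  Prop :=
  Lpw Om p (wsv s v mi0) f /\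
  forall a : mi, (0 < mabs a <= m)%N ->
    exists g, wderiv_v Om (wsv s v mi0) v a f g /\ Lpw Om p (wsv s v a) g.

Definition wderiv (Om : set Rd) (a : mi) (f g : Rd -> R) : Prop :=
  Lpw_loc Om 1 (fun=> 1) f /\ Lpw_loc Om 1 (fun=> 1) g /\
  forall phi, testfun Om phi ->
    intO Om (fun x => f x * dpart a phi x)
    = (((-1) ^+ mabs a)%:E * intO Om (fun x => (phi x * g x)%R))%E.

Definition Wmp (Om : set Rd) (m : nat) (p : R) (f : Rd -> R) : Prop :=
  Lpw Om p (fun=> 1) f /\
  forall a : mi, (0 < mabs a <= m)%N ->
    exists g, wderiv Om a f g /\ Lpw Om p (fun=> 1) g.

(* D^0_v f := f *)
Definition withf (f : Rd -> R) (G : mi -> Rd -> R) : mi -> Rd -> R :=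
  fun a => if a == mi0 then f else G a.

(* ||F - f||^p in W^{m,p}_{s,v}: F, f with families of weak v-derivatives
   GF, Gf *)
Definition Wsv_distp (Om : set Rd) (m : nat) (p : R) (s : mi -> R)
  (v : Rd -> R) (F f : Rd -> R) (GF Gf : mi -> Rd -> R) : \bar R :=
  sum_pi m (fun a => intnn Om (fun x =>
     powR `|(withf F GF a x - withf f Gf a x) * wsv s v a x| p)).

End defs.

(* Main.v *)
(* With chi = eta (n v), the weak v-derivative of chi f is given by Leibniz'
   rule sum_(b <= a) C(a, b) (d^(a-b) chi) D_v^b f.  Indeed, inverting Leibniz'
   rule, f chi d^a psi is a signed sum of terms f d^b xi with
   xi = (d^(a-b) chi) psi, and xi is supported where |v| >= 1/(2n); there
   xi / v^(|b|+1) is of class C^|b|, so that the defining identity of D_v^b f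
   applies to it, once it has been extended from smooth test functions to test
   functions of class C^|b|.  The latter density is obtained by
   quasi-interpolation on a fine grid with kernels whose derivatives are finite
   differences of kernels, so that no convolution is needed.

   By Faa di Bruno, the hypothesis on v and the superadditivity of s,
   |d^(a-b) chi| <= C' n^(s (a-b)), with support in 1/(2n) < |v| <= 1/n for
   b <> a; there |v|^(s a - s b) <= n^(- s (a-b)), hence each term of
   D_v^a (chi f) - D_v^a f is dominated, uniformly in n, by
   |v|^(s b + 1) |D_v^b f|, which is in L^p.  Each term vanishes eventually at
   every point where v <> 0, and dominated convergence concludes.

   Iterated derivatives are indexed by words, so that Leibniz' rule is a sum over
   the splittings of a word in two subwords rather than over multi-indices. *)

Require Import Defs.
From HB Require Import structures.
From mathcomp Require Import all_boot all_order all_algebra.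
From mathcomp Require Import all_classical all_reals all_analysis.
From mathcomp Require Import measurable_realfun ring lra.
Import Order.TTheory GRing.Theory Num.Theory.
Import numFieldNormedType.Exports.
Local Open Scope classical_set_scope.
Local Open Scope ring_scope.
Set Implicit Arguments.
Unset Strict Implicit.
Unset Printing Implicit Defensive.

(** * Lebesgue measure on R^d *)

Section euclidean_space.
Variable R : realType.

(** [intRd] is only an iterated integral; a measure representing it on Borel functions gives access
    to dominated convergence. Test functions of finite regularity are forced twice:
    [v ^+ k.+1 * phi] is no smoother than [v], and neither is its quotient by another power of [v].
    The inverted Leibniz rule leaves [f] undifferentiated under the integral, the only form in which
    the definition of the weak derivative applies. One identity, for [psi] of class C^|a| with
    compact support in [Om], serves twice: [psi = v^(|a|+1) phi] yields the weak v-derivative of chi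
    f, and [psi = phi] the ordinary one. Two bounds on the derivatives of chi are kept apart. For
    fixed n they are at most a multiple of any nonnegative power of |v|, because |v| > 1/(2n)
    wherever they do not vanish; this puts chi f in W^{m,p}. Uniformly in n, only weights [wsv] of
    different orders can be traded for one another; this gives the limit. Finite differences have
    two uses: the symmetry of iterated partial derivatives and the smooth approximation. *)

Lemma norm_rV_leP n (x : 'rV[R]_n) (e : R) : 0 <= e ->
  (`|x| <= e) <-> (forall i, `|x 0 i| <= e).
Proof.
move=> e0; rewrite [`|x|]/Num.Def.normr/= mx_normrE; split.
  by move=> /bigmax_leP[_ h] i; exact: (h (0, i)).
by move=> h; apply/bigmax_leP; split => // -[i j] _ /=; rewrite (ord1 i).
Qed.

Lemma ball_rVP n (x y : 'rV[R]_n) (e : R) : 0 < e ->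
  ball x e y <-> (forall i, `|x 0 i - y 0 i| < e).
Proof.
move=> e0; split => [[_ h] i|h]; first exact: (h 0 i).
by split => // i j; rewrite (ord1 i); exact: h.
Qed.

(** The index set is countable, so measurability of a map into ['rV[R]_n] can be checked on balls,
    which are boxes for the sup norm. *)
Lemma open_bigcup_rat_ball n (U : set 'rV[R]_n) : open U ->
  U = \bigcup_(k in [set k : 'rV[rat]_n * nat |
        ball (map_mx ratr k.1 : 'rV[R]_n) k.2.+1%:R^-1 `<=` U])
      ball (map_mx ratr k.1 : 'rV[R]_n) k.2.+1%:R^-1.
Proof.
move=> oU; apply/seteqP; split => [x Ux|x [k kU]]; last exact: kU.
have /nbhs_ballP[e /= e0 xeU] : nbhs x U by exact: open_nbhs_nbhs.
(* Two radii [1/(m+1)] add up to at most [e]: one from [x] to the rational centre, one from there to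
   [y]. *)
pose m := Num.truncn (2 / e).
have m0 : 0 < m.+1%:R^-1 :> R by rewrite invr_gt0.
have me : m.+1%:R^-1 + m.+1%:R^-1 <= e.
  rewrite -mulr2n -[_ *+ 2]mulr_natl ler_pdivrMr// mulrC -ler_pdivrMr//.
  by apply: ltW; exact: truncnS_gt.
have /choice[q qP] (i : 'I_n) : exists q : rat,
    ratr q \in `]x 0 i - m.+1%:R^-1, x 0 i + m.+1%:R^-1[.
  by apply: rat_in_itvoo; rewrite ltrD2l gtrN.
have qx : ball (map_mx ratr (\row_i q i) : 'rV[R]_n) m.+1%:R^-1 x.
  apply/ball_rVP => // i; rewrite !mxE.
  have := qP i; rewrite in_itv/= => /andP[qi1 qi2].
  by rewrite distrC ltr_distlC qi1 qi2.
exists (\row_i q i, m) => //= y qy; apply: xeU.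
by apply: (le_ball me); apply: ball_triangle qy; exact: ball_sym.
Qed.

End euclidean_space.

Notation borelT R n := (g_sigma_algebraType [set B : set 'rV[R]_n | open B]).

Section sigma_finite_pack.
Context d (T : measurableType d) (R : realType) (mu : {measure set T -> \bar R}).

(** The proof of sigma-finiteness is an argument, so that a canonical instance can be attached to
    the alias. *)
Definition sf_measure of sigma_finite setT mu : set T -> \bar R := mu.
Hypothesis sf : sigma_finite setT mu.
HB.instance Definition _ := Measure.copy (sf_measure sf) mu.
HB.instance Definition _ := Measure_isSigmaFinite.Build d T R (sf_measure sf) sf.

Lemma sigma_finite_measureW : exists mu' : {sigma_finite_measure set T -> \bar R},
  forall A, mu' A = mu A.
Proof. by exists (sf_measure sf). Qed.

End sigma_finite_pack.

Section borel_space.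
Variable R : realType.

Lemma borel_open n (U : set 'rV[R]_n) : open U -> measurable (U : set (borelT R n)).
Proof. exact: sub_sigma_algebra. Qed.

Lemma borel_closed n (U : set 'rV[R]_n) :
  closed U -> measurable (U : set (borelT R n)).
Proof.
move=> cU; rewrite -(setCK U); apply: measurableC.
by apply: borel_open; exact: closed_openC.
Qed.

(** The coordinates [(t, y)] of the recursion of [intRd]; measures are pushed forward along this
    map. *)
Definition rowcons n (z : R * borelT R n) : borelT R n.+1 :=
  row_mx (z.1%:M : 'M[R]_1) z.2.

Lemma rowcons0 n (z : R * borelT R n) : rowcons z 0 0 = z.1.
Proof.
have -> : (0 : 'I_(1 + n)) = lshift n 0 by exact/val_inj.
by rewrite [LHS]row_mxEl mxE eqxx.
Qed.

Lemma rowconsS n (z : R * borelT R n) i : rowcons z 0 (lift ord0 i) = z.2 0 i.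
Proof.
have -> : lift ord0 i = rshift 1 i :> 'I_(1 + n) by exact/val_inj.
by rewrite [LHS]row_mxEr.
Qed.

Lemma measurable_rowcons n : measurable_fun setT (@rowcons n).
Proof.
apply: (@measurability _ _ _ (borelT R n.+1) _ _ [set B : set 'rV[R]_n.+1 | open B]) => // _ [U oU <-]; rewrite setTI.
rewrite (open_bigcup_rat_ball oU) preimage_bigcup.
rewrite bigcup_mkcond; apply: countable_bigcupT_measurable => //= -[q k].
case: ifPn => _ //.
rewrite (_ : _ @^-1` _ = ball (ratr (q 0 0) : R) k.+1%:R^-1 `*`
    ball (map_mx ratr (\row_i q 0 (lift ord0 i)) : 'rV[R]_n) k.+1%:R^-1).
  apply: measurableX; first by apply: measurable_realfun.open_measurable; exact: ball_open.
  by apply: borel_open; exact: ball_open.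
have k0 : 0 < k.+1%:R^-1 :> R by rewrite invr_gt0.
apply/seteqP; split => z.
  move=> /(ball_rVP _ _ k0) h; split.
    by have := h 0; rewrite rowcons0 mxE.
  by apply/(ball_rVP _ _ k0) => i; have := h (lift ord0 i); rewrite rowconsS !mxE.
move=> [h0 /(ball_rVP _ _ k0) hS]; apply/(ball_rVP _ _ k0) => i.
have [j ->|->] := unliftP ord0 i.
  by have := hS j; rewrite rowconsS !mxE.
by rewrite rowcons0 mxE.
Qed.

Lemma measurable_box n (e : R) :
  measurable ([set x | `|x : 'rV[R]_n| <= e] : set (borelT R n)).
Proof.
apply: borel_closed.
rewrite (_ : mkset _ = (fun x : 'rV[R]_n => `|x|) @^-1` [set t : R | t <= e]) //.
apply: closed_comp; last exact: closed_le.
by move=> x _; exact: norm_continuous.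
Qed.

Lemma sigma_finite_of_boxes n (mu : {measure set (borelT R n) -> \bar R}) :
  (forall k : nat, (mu [set x | (`|x : 'rV[R]_n| <= k%:R)%R] < +oo)%E) ->
  sigma_finite setT mu.
Proof.
move=> h; exists (fun k => [set x | `|x : 'rV[R]_n| <= k%:R]).
  apply/esym/seteqP; split => // x _; exists (Num.truncn `|x : 'rV[R]_n|).+1 => //=.
  by apply: ltW; exact: truncnS_gt.
by move=> k; split => //; exact: measurable_box.
Qed.

(** In dimension n+1 the measure is the image under [rowcons] of the product of [lebesgue_measure]
    and the measure in dimension n; Tonelli's theorem gives the recursive clause of [intRd].
    Finiteness on boxes is part of the induction because it yields the sigma-finiteness required by
    the next product. *)
Theorem intRd_measure n : exists mu : {sigma_finite_measure set (borelT R n) -> \bar R},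
  (forall k : nat, (mu [set x | (`|x : 'rV[R]_n| <= k%:R)%R] < +oo)%E) /\
  forall f : borelT R n -> \bar R, measurable_fun setT f -> (forall x, 0 <= f x)%E ->
    (intRd f = \int[mu]_x f x)%E.
Proof.
elim: n => [|n [mu [muk IH]]].
  pose mu0 : {measure set (borelT R 0) -> \bar R} := \d_ (0 : borelT R 0).
  have mu0k (k : nat) : (mu0 [set x | (`|x : 'rV[R]_0| <= k%:R)%R] < +oo)%E.
    by rewrite /mu0 /= diracE; case: (_ \in _); rewrite ltry.
  have [mu muE] := sigma_finite_measureW (sigma_finite_of_boxes mu0k).
  exists mu; split => [k|f mf f0 /=]; first by rewrite muE.
  rewrite (eq_measure_integral mu0) => [|A _ _]; last exact: muE.
  by rewrite integral_dirac//= diracT mul1e.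
pose mu1f : {measure set (borelT R n.+1) -> \bar R} :=
  pushforward (@lebesgue_measure R \x mu)%E (@rowcons n).
pose mu1 := mu1f (@measurable_rowcons n).
have mu1k (k : nat) : (mu1 [set x | (`|x : 'rV[R]_n.+1| <= k%:R)%R] < +oo)%E.
  rewrite /mu1/= /pushforward.
  rewrite (_ : _ @^-1` _ = `[- k%:R, k%:R]%classic `*`
      [set y | (`|y : 'rV[R]_n| <= k%:R)%R]).
    rewrite product_measure1E//; last exact: measurable_box.
    rewrite lte_mul_pinfty//.
      have := @lebesgue_measure_itv R `[- k%:R, k%:R]; rewrite /= => ->.
      by case: ifPn => _ //; rewrite -EFinB.
  apply/seteqP; split => z /=.
    move=> /(norm_rV_leP _ (ler0n _ _)) h; split; rewrite /= ?in_itv/=.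
      by rewrite -ler_norml -rowcons0; exact: h.
    by apply/(norm_rV_leP _ (ler0n _ _)) => i; rewrite -rowconsS; exact: h.
  rewrite in_itv/= -ler_norml => -[h0 /(norm_rV_leP _ (ler0n _ _)) hS].
  apply/(norm_rV_leP _ (ler0n _ _)) => i.
  by have [j ->|->] := unliftP ord0 i; rewrite ?rowconsS ?rowcons0//; exact: hS.
have [mu' mu'E] := sigma_finite_measureW (sigma_finite_of_boxes mu1k).
exists mu'; split => [k|f mf f0 /=]; first by rewrite mu'E.
have mfr : measurable_fun setT (f \o @rowcons n).
  by apply: measurableT_comp => //; exact: measurable_rowcons.
rewrite (eq_measure_integral mu1) => [|A _ _]; last exact: mu'E.
rewrite ge0_integral_pushforward//.
rewrite preimage_setT fubini_tonelli1//=.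
  apply: eq_integral => t _; rewrite /fubini_F -IH//; last by move=> y /=.
  exact: measurableT_comp.
exact: measurable_rowcons.
Qed.

End borel_space.

(** * Functions of class C^k *)

Section Ck_functions.
Variables (R : realType) (d : nat).
Local Notation Rd := ('rV[R]_d).
Implicit Types (U : set Rd) (f g : Rd -> R) (s : seq 'I_d).

Lemma dlist_cat s1 s2 g : dlist (s1 ++ s2) g = dlist s1 (dlist s2 g).
Proof. exact: foldr_cat. Qed.

Lemma dlist_rcons s i g : dlist (rcons s i) g = dlist s (pderiv i g).
Proof. exact: foldr_rcons. Qed.

Lemma eq_pderiv U i f g : open U -> (forall x, U x -> f x = g x) ->
  forall x, U x -> pderiv i f x = pderiv i g x.
Proof.
move=> oU fg x Ux; apply: near_eq_derive.
by near=> y; apply: fg; near: y; exact: open_nbhs_nbhs.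
Unshelve. all: by end_near. Qed.

Lemma eq_dlist U s f g : open U -> (forall x, U x -> f x = g x) ->
  forall x, U x -> dlist s f x = dlist s g x.
Proof.
move=> oU fg; elim: s => // i s IH x Ux /=.
exact: eq_pderiv IH x Ux.
Qed.

Lemma Ck0P U g : Ck U 0 g <-> forall x, U x -> {for x, continuous g}.
Proof.
split=> [[c _]|c]; first exact: (c [::]).
by split=> // -[].
Qed.

(** The last letter of a word is the derivative taken innermost. Splitting it off turns [Ck] into a
    recursion on [k], which drives most closure properties below. *)
Lemma CkSP U k g : Ck U k.+1 g <->
  [/\ forall x, U x -> {for x, continuous g},
      forall i x, U x -> derivable g x (@unitv R d i) &
      forall i, Ck U k (pderiv i g)].
Proof.
split=> [[c e]|[c e h]].
  split; [exact: (c [::])|exact: (e [::])|move=> i; split => s sk].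
    by rewrite -dlist_rcons; apply: c; rewrite size_rcons.
  by rewrite -dlist_rcons; apply: e; rewrite size_rcons.
split; move=> s; have [->|[t [i ->]]] : s = [::] \/ exists t i, s = rcons t i.
- by case/lastP: s; [left|right; do 2 eexists].
- by move=> _; exact: c.
- by rewrite size_rcons dlist_rcons; exact: (h i).1.
- by case/lastP: s; [left|right; do 2 eexists].
- by move=> _; exact: e.
- by rewrite size_rcons dlist_rcons; exact: (h i).2.
Qed.

Lemma Ck_le U k l g : (l <= k)%N -> Ck U k g -> Ck U l g.
Proof.
move=> lk [c e]; split=> s sl; first by apply: c; exact: leq_trans lk.
by apply: e; exact: leq_trans lk.
Qed.

Lemma Ck_subset U V k g : V `<=` U -> Ck U k g -> Ck V k g.
Proof.
by move=> VU [c e]; split=> [s sk x /VU|s sk i x /VU]; [exact: c|exact: e].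
Qed.

Lemma CkU U V k g : Ck U k g -> Ck V k g -> Ck (U `|` V) k g.
Proof.
move=> [c e] [c' e']; split=> [s sk x [|]|s sk i x [|]];
  by [exact: c|exact: c'|exact: e|exact: e'].
Qed.

Lemma Ck_dlist U k s g : Ck U (size s + k) g -> Ck U k (dlist s g).
Proof.
move=> [c e]; split=> t tk; rewrite -dlist_cat.
  by apply: c; rewrite size_cat addnC leq_add2l.
by apply: e; rewrite size_cat addnC ltn_add2l.
Qed.

Lemma Ck_cont U k g : Ck U k g -> forall x, U x -> {for x, continuous g}.
Proof. by move=> [c _]; exact: (c [::]). Qed.

Lemma eq_Ck U k f g : open U -> (forall x, U x -> f x = g x) -> Ck U k f -> Ck U k g.
Proof.
move=> oU fg [c e].
have nfg s x : U x -> {near x, dlist s f =1 dlist s g}.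
  by move=> Ux; near=> y; apply: (eq_dlist _ oU fg); near: y; exact: open_nbhs_nbhs.
split=> [s sk x Ux|s sk i x Ux].
  have cf : dlist s f @ x --> dlist s f x := c s sk x Ux.
  have cg : dlist s g @ x --> dlist s g x.
    rewrite -(eq_dlist s oU fg Ux).
    exact: cvg_trans (near_eq_cvg (nfg s x Ux)) cf.
  exact: cg.
by apply: near_eq_derivable; [exact: nfg|exact: e].
Unshelve. all: by end_near. Qed.

Lemma derivable_line g x (u : Rd) :
  derivable g x u <-> derivable (fun h : R => g (h *: u + x)) 0 1.
Proof. exact: derivable1P. Qed.

Lemma derive_line g x (u : Rd) :
  'D_u g x = derive1 (fun h : R => g (h *: u + x)) 0.
Proof.
rewrite derive1E /derive.
under [in RHS]eq_fun do rewrite /= addr0 scale0r add0r [_%:A]mulr1.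
by [].
Qed.

Lemma Ck_cst U k (a : R) : Ck U k (fun=> a).
Proof.
elim: k a => [|k IH] a; first by apply/Ck0P => x _; exact: cst_continuous.
apply/CkSP; split => [x _|i x _|i]; [exact: cst_continuous|exact: derivable_cst|].
suff -> : pderiv i (fun _ : Rd => a) = fun=> 0 by exact: IH.
by apply/funext => x; exact: derive_cst.
Qed.

Lemma CkD U k f g : open U -> Ck U k f -> Ck U k g -> Ck U k (fun x => f x + g x).
Proof.
move=> oU; elim: k f g => [|k IH] f g.
  by move=> /Ck0P cf /Ck0P cg; apply/Ck0P => x Ux; apply: continuousD; [exact: cf|exact: cg].
move=> /CkSP[cf df hf] /CkSP[cg dg hg]; apply/CkSP; split.
- by move=> x Ux; apply: continuousD; [exact: cf|exact: cg].
- by move=> i x Ux; apply: derivableD; [exact: df|exact: dg].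
- move=> i; apply: (eq_Ck oU _ (IH _ _ (hf i) (hg i))) => x Ux.
  by rewrite /pderiv deriveD//; [exact: df|exact: dg].
Qed.

Lemma pderivM U i f g x : Ck U 1 f -> Ck U 1 g -> U x ->
  pderiv i (fun x => f x * g x) x = pderiv i f x * g x + f x * pderiv i g x.
Proof.
move=> /CkSP[_ df _] /CkSP[_ dg _] Ux.
rewrite /pderiv deriveM; [|exact: df|exact: dg].
by rewrite addrC; congr (_ + _); rewrite /GRing.scale/= mulrC.
Qed.

Lemma CkM U k f g : open U -> Ck U k f -> Ck U k g -> Ck U k (fun x => f x * g x).
Proof.
move=> oU; elim: k f g => [|k IH] f g.
  by move=> /Ck0P cf /Ck0P cg; apply/Ck0P => x Ux; apply: continuousM; [exact: cf|exact: cg].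
move=> Cf Cg; move: (Cf) (Cg) => /CkSP[cf df hf] /CkSP[cg dg hg]; apply/CkSP; split.
- by move=> x Ux; apply: continuousM; [exact: cf|exact: cg].
- by move=> i x Ux; apply: derivableM; [exact: df|exact: dg].
- move=> i.
  have := CkD oU (IH _ _ (hf i) (Ck_le (leqnSn k) Cg)) (IH _ _ (Ck_le (leqnSn k) Cf) (hg i)).
  apply: eq_Ck => // x Ux.
  by rewrite (pderivM i (Ck_le (ltn0Sn k) Cf) (Ck_le (ltn0Sn k) Cg) Ux).
Qed.

Lemma CkX U k n f : open U -> Ck U k f -> Ck U k (fun x => f x ^+ n).
Proof.
move=> oU Cf; elim: n => [|n IH]; first exact: Ck_cst.
by apply: (eq_Ck oU _ (CkM oU Cf IH)) => x _; rewrite exprS.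
Qed.

Lemma Ck_sum (I : Type) (r : seq I) U k (F : I -> Rd -> R) : open U ->
  (forall i, Ck U k (F i)) -> Ck U k (fun x => \sum_(i <- r) F i x).
Proof.
move=> oU CF; elim: r => [|i r IH].
  by apply: (eq_Ck oU _ (Ck_cst U k 0)) => x _; rewrite big_nil.
by apply: (eq_Ck oU _ (CkD oU (CF i) IH)) => x _; rewrite big_cons.
Qed.

Lemma CkV U k f : open U -> (forall x, U x -> f x != 0) ->
  Ck U k f -> Ck U k (fun x => (f x)^-1).
Proof.
move=> oU f0; elim: k => [|k IH] Cf.
  by apply/Ck0P => x Ux; apply: continuousV; [exact: f0|exact: (Ck_cont Cf)].
have IHk := IH (Ck_le (leqnSn k) Cf).
move: (Cf) => /CkSP[cf df hf]; apply/CkSP; split.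
- by move=> x Ux; apply: continuousV; [exact: f0|exact: (Ck_cont Cf)].
- by move=> i x Ux; apply: derivableV; [exact: f0|exact: df].
- move=> i.
  have := CkM oU (CkM oU (CkM oU (Ck_cst U k (-1)) (hf i)) IHk) IHk.
  apply: eq_Ck => // x Ux.
  rewrite /pderiv deriveV; [|exact: f0|exact: df].
  by rewrite /GRing.scale/= expr2 invfM; ring.
Qed.

Definition smooth1 (G : R -> R) := forall k t, derivable (iter k (@derive1 R R) G) t 1.

Lemma smooth1_derive G : smooth1 G -> smooth1 (derive1 G).
Proof. by move=> sG k t; rewrite -iterSr; exact: sG. Qed.

Lemma smooth1_cont G : smooth1 G -> continuous G.
Proof.
by move=> sG t; apply: differentiable_continuous; apply/derivable1_diffP; exact: (sG 0%N).
Qed.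

Lemma derivable_compR (G : R -> R) g x u : (forall t, derivable G t 1) ->
  derivable g x u -> derivable (fun y : Rd => G (g y)) x u.
Proof.
move=> dG /derivable_line dg; apply/derivable_line.
apply/derivable1_diffP; apply: (@differentiable_comp _ _ _ _ (fun h : R => g (h *: u + x)) G).
  exact/derivable1_diffP.
by move/derivable1_diffP: (dG (g (0 *: u + x))).
Qed.

Lemma derive_compR (G : R -> R) g x u : (forall t, derivable G t 1) ->
  derivable g x u -> 'D_u (fun y : Rd => G (g y)) x = derive1 G (g x) * 'D_u g x.
Proof.
move=> dG /derivable_line dg; rewrite !derive_line.
have := @derive1_comp _ (fun h : R => g (h *: u + x)) G 0 dg (dG _).
by rewrite scale0r add0r => <-.
Qed.

Lemma Ck_compR U k (G : R -> R) g : open U -> smooth1 G -> Ck U k g ->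
  Ck U k (fun x => G (g x)).
Proof.
move=> oU; elim: k G => [|k IH] G sG Cg.
  apply/Ck0P => x Ux; apply: continuous_comp; first exact: (Ck_cont Cg).
  exact: smooth1_cont.
have dG := sG 0%N.
move: (Cg) => /CkSP[cg dg hg]; apply/CkSP; split.
- move=> x Ux; apply: continuous_comp; first exact: cg.
  exact: smooth1_cont.
- by move=> i x Ux; apply: derivable_compR => //; exact: dg.
- move=> i.
  have := CkM oU (IH _ (smooth1_derive sG) (Ck_le (leqnSn k) Cg)) (hg i).
  by apply: eq_Ck => // x Ux; rewrite /pderiv derive_compR//; exact: dg.
Qed.

(* Away from the support everything vanishes, so regularity on a neighbourhood
   of the support is regularity everywhere. *)
Lemma Ck_setT U K k g : open U -> closed K -> K `<=` U -> Ck U k g ->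
  (forall x, ~ K x -> g x = 0) -> Ck setT k g.
Proof.
move=> oU cK KU Cg g0.
have -> : [set: Rd] = U `|` ~` K.
  by apply/esym/seteqP; split => // x _; have [/KU|] := pselect (K x); [left|right].
apply: CkU => //; apply: (eq_Ck (closed_openC cK) _ (Ck_cst _ k 0)) => x Kx.
by rewrite g0.
Qed.

Lemma dlist_supp K s g : closed K -> (forall x, ~ K x -> g x = 0) ->
  forall x, ~ K x -> dlist s g x = 0.
Proof.
move=> cK g0 x Kx.
rewrite (@eq_dlist (~` K) s g (fun=> 0) (closed_openC cK))//.
elim: s x {Kx} => //= i s IH x; rewrite /pderiv.
have -> : dlist s (fun _ : Rd => 0 : R) = fun=> 0 by apply/funext.
exact: derive_cst.
Qed.

End Ck_functions.

(** * Finite differences and symmetry of partial derivatives *)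

Section finite_differences.
Variables (R : realType) (d : nat).
Local Notation Rd := ('rV[R]_d).
Local Notation e_ := (@unitv R d).
Implicit Types (U : set Rd) (f g : Rd -> R) (s : seq 'I_d) (h : R).

Lemma norm_unitv i : `|e_ i| <= 1.
Proof.
apply/norm_rV_leP => // j; rewrite /unitv mxE eqxx/=.
by case: (_ == _); rewrite ?normr1 ?normr0.
Qed.

Lemma derivable_along g i (y : Rd) (t : R) :
  derivable g (t *: e_ i + y) (e_ i) ->
  is_derive t 1 (fun t => g (t *: e_ i + y)) (pderiv i g (t *: e_ i + y)).
Proof.
move=> dg.
have E : (fun k : R => g (k *: e_ i + (t *: e_ i + y))) =
    (fun k => (fun t : R => g (t *: e_ i + y)) (k *: (1 : R) + t)).
  by apply/funext => k; rewrite [_ *: (1 : R)]mulr1 scalerDl addrA.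
have dF : derivable (fun t : R => g (t *: e_ i + y)) t 1.
  by apply/derivable1P; move/derivable_line : dg; rewrite E.
apply: DeriveDef => //.
rewrite /pderiv derive_line E -derive1E /derive1.
under [in RHS]eq_fun do rewrite addr0 scale0r add0r [_%:A]mulr1.
by [].
Qed.

(** Backward differences match [derive1 (rho r.+1) t = rho r t - rho r (t - 1)] for the kernels
    below, after summation by parts. *)
Definition fdiff h i g : Rd -> R := fun x => h^-1 * (g x - g (x - h *: e_ i)).
Definition fdiffs h s g : Rd -> R := foldr (fdiff h) g s.

Lemma fdiffC h i j g : fdiff h i (fdiff h j g) = fdiff h j (fdiff h i g).
Proof.
apply/funext => x; rewrite /fdiff.
have -> : x - h *: e_ i - h *: e_ j = x - h *: e_ j - h *: e_ i by rewrite addrAC.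
by ring.
Qed.

Lemma fdiffs_fdiff h i s g : fdiff h i (fdiffs h s g) = fdiffs h s (fdiff h i g).
Proof. by elim: s => //= j s IH; rewrite fdiffC IH. Qed.

Lemma fdiffs_cat h s1 s2 g : fdiffs h (s1 ++ s2) g = fdiffs h s1 (fdiffs h s2 g).
Proof. exact: foldr_cat. Qed.

(** Difference operators commute whatever the regularity of [g]; the symmetry of partial derivatives
    is inherited from this. *)
Lemma perm_fdiffs h s s' g : perm_eq s s' -> fdiffs h s g = fdiffs h s' g.
Proof.
elim: s s' => [|i s IH] s'; first by rewrite perm_sym => /perm_nilP ->.
move=> pss'; have : i \in s' by rewrite -(perm_mem pss') mem_head.
move=> is'; move: pss'; case/splitPr: is' => s1 s2.
rewrite perm_sym perm_catC/= perm_cons perm_catC perm_sym => /IH E.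
by rewrite -[LHS]/(fdiff h i (fdiffs h s g)) E !fdiffs_cat fdiffs_fdiff.
Qed.

Lemma pderiv_fdiff U h i j g x : Ck U 1 g -> U x -> U (x - h *: e_ j) ->
  pderiv i (fdiff h j g) x = fdiff h j (pderiv i g) x.
Proof.
move=> /CkSP[_ dg _] Ux Uy.
have dgs : is_derive x (e_ i) (fun y => g (y - h *: e_ j)) (pderiv i g (x - h *: e_ j)).
  have E : (fun k : R => g (k *: e_ i + x - h *: e_ j)) =
      (fun k : R => g (k *: e_ i + (x - h *: e_ j))).
    by apply/funext => k; rewrite addrA.
  apply: DeriveDef.
    by apply/derivable_line; rewrite E; apply/derivable_line; exact: dg.
  by rewrite derive_line E -derive_line.
have [_ E] := is_deriveZ h^-1 (is_deriveB (derivableP (dg i x Ux)) dgs).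
exact: E.
Qed.

Lemma subr_continuous (a : Rd) : continuous (fun y : Rd => y - a).
Proof.
by move=> y; apply: (@cvgB _ _ _ _ _ id (cst a)) => //; [exact: (nbhs_filter y)|exact: (@cst_continuous Rd Rd a y)].
Qed.

Lemma open_shift U (a : Rd) : open U -> open [set y | U (y - a)].
Proof.
move=> oU; rewrite (_ : mkset _ = (fun y : Rd => y - a) @^-1` U)//; apply: open_comp => // y _.
exact: subr_continuous.
Qed.

Lemma dlist_fdiff U h j s g : open U -> Ck U (size s) g ->
  forall x, U x -> U (x - h *: e_ j) -> dlist s (fdiff h j g) x = fdiff h j (dlist s g) x.
Proof.
move=> oU; elim: s => // i s IH Cg x Ux Uy /=.
pose V := U `&` [set y | U (y - h *: e_ j)].
have oV : open V.
  by apply: openI => //; exact: open_shift.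
rewrite (@eq_pderiv _ _ V i _ (fdiff h j (dlist s g)))//.
  rewrite (@pderiv_fdiff U)//.
  by apply: Ck_dlist; rewrite addn1.
by move=> y [Uy' Vy]; apply: IH => //; exact: (Ck_le (leqnSn _) Cg).
Qed.

Lemma pderiv_shift i (a : Rd) g :
  pderiv i (fun y => g (y - a)) = fun y => pderiv i g (y - a).
Proof.
apply/funext => y; rewrite /pderiv !derive_line; congr (derive1 _ 0).
by apply/funext => k; rewrite addrA.
Qed.

Lemma Ck_shift U V k (a : Rd) g : (forall y, V y -> U (y - a)) ->
  Ck U k g -> Ck V k (fun y => g (y - a)).
Proof.
move=> VU; elim: k g => [|k IH] g.
  move=> /Ck0P cg; apply/Ck0P => y /VU Uy.
  apply: (@continuous_comp _ _ _ (fun y : Rd => y - a) g); last exact: cg.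
  exact: subr_continuous.
move=> /CkSP[cg dg hg]; apply/CkSP; split.
- move=> y /VU Uy; apply: (@continuous_comp _ _ _ (fun y : Rd => y - a) g); last exact: cg.
  exact: subr_continuous.
- move=> i y /VU Uy; apply/derivable_line; have /derivable_line := dg i _ Uy.
  rewrite (_ : (fun h => _) = (fun h : R => g (h *: e_ i + y - a)))//.
  by apply/funext => h; rewrite addrA.
- by move=> i; rewrite pderiv_shift; exact: IH.
Qed.

(** Since differences commute, the one along [e_i] can be applied to [g] before the others: the
    induction hypothesis for [fdiff h i g] gives a point [xi], and the mean value theorem for
    [dlist s g] on the segment from [xi - h *: e_i] to [xi] gives the final one. [U] varies in the
    induction because [fdiff h i g] is known to be regular only where both the point and its shift
    lie in [U]. *)
Lemma fdiffs_mean_value U h s g x : open U -> 0 < h -> Ck U (size s) g ->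
  (forall y, `|y - x| <= (size s)%:R * h -> U y) ->
  exists2 xi, `|xi - x| <= (size s)%:R * h & fdiffs h s g x = dlist s g xi.
Proof.
move=> oU h0; elim: s U g oU => [|i s IH] U g oU Cg Ux.
  by exists x => //=; rewrite subrr normr0 mul0r.
pose V := U `&` [set y | U (y - h *: e_ i)].
have oV : open V.
  by apply: openI => //; exact: open_shift.
have he : `|h *: e_ i| <= h by rewrite normrZ gtr0_norm// ger_pMr// norm_unitv.
have sS : (size s).+1%:R * h = (size s)%:R * h + h by rewrite -natr1 mulrDl mul1r.
have UV y : `|y - x| <= (size s)%:R * h -> V y.
  move=> yx; split; apply: Ux; rewrite /= sS.
    by apply: le_trans yx _; rewrite lerDl ltW.
  by rewrite addrAC (le_trans (ler_normB _ _))// lerD.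
have CV : Ck V (size s) (fdiff h i g).
  have Cgs : Ck V (size s) (fun y => g (y - h *: e_ i)).
    by apply: (@Ck_shift U) => [y []//|]; exact: (Ck_le (leqnSn _) Cg).
  have CgV : Ck V (size s) g by apply: Ck_subset (Ck_le (leqnSn _) Cg) => // y [].
  apply: (eq_Ck oV _ (CkM oV (Ck_cst _ _ h^-1) (CkD oV CgV (CkM oV (Ck_cst _ _ (-1)) Cgs)))).
  by move=> y _; rewrite /fdiff mulN1r.
have [xi xix E] := IH V (fdiff h i g) oV CV UV.
have [Uxi Uxih] := UV _ xix.
rewrite /= fdiffs_fdiff E (dlist_fdiff oU)//; last exact: (Ck_le (leqnSn _) Cg).
pose y := xi - h *: e_ i.
have Uy t : t \in `[0, h]%R -> U (t *: e_ i + y) /\ `|t *: e_ i + y - x| <= (size s).+1%:R * h.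
  rewrite in_itv/= => /andP[t0 th].
  suff yx : `|t *: e_ i + y - x| <= (size s).+1%:R * h by split => //; exact: Ux.
  have -> : t *: e_ i + y - x = (xi - x) - (h - t) *: e_ i.
    by apply/rowP => j; rewrite /y !mxE; ring.
  rewrite sS (le_trans (ler_normB _ _))// lerD// normrZ ger0_norm ?subr_ge0//.
  by rewrite (le_trans (ler_piMr _ (norm_unitv i)))// ?subr_ge0// gerBl.
pose F (t : R) := dlist s g (t *: e_ i + y).
pose F' (t : R) := pderiv i (dlist s g) (t *: e_ i + y).
have dF t : t \in `[0, h]%R -> is_derive t 1 F (F' t).
  by move=> /Uy[Ut _]; apply: derivable_along; have [_ de] := Cg; exact: (de s).
have dF' t : t \in `]0, h[%R -> is_derive t 1 F (F' t).
  by rewrite in_itv/= => /andP[t0 th]; apply: dF; rewrite in_itv/= !ltW.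
have cF : {within `[0, h], continuous F}.
  by apply: derivable_within_continuous => t th; case: (dF t th).
have [t th FE] := MVT_segment (ltW h0) dF' cF.
exists (t *: e_ i + y); first by have [] := Uy _ th.
have F0 : F 0 = dlist s g (xi - h *: e_ i) by rewrite /F scale0r add0r.
have Fh : F h = dlist s g xi by rewrite /F /y addrC subrK.
by rewrite /fdiff -F0 -Fh FE subr0 mulrCA mulVf ?mulr1// gt_eqF.
Qed.

(** Schwarz's theorem for words: [s] and [s'] have the same difference quotient at [x], which is the
    value of either derivative at some point close to [x]. Continuity of both derivatives
    concludes. *)
Lemma dlist_perm U s s' g x : open U -> Ck U (size s) g -> perm_eq s s' -> U x ->
  dlist s g x = dlist s' g x.
Proof.
move=> oU Cg pss' Ux; apply/eqP; rewrite -subr_eq0 -normr_le0.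
apply/ler_addgt0Pl => e e0; rewrite addr0.
have [c _] := Cg.
have e20 : 0 < e / 2 by rewrite divr_gt0.
have ss' := perm_size pss'.
have near_dlist t : (size t <= size s)%N ->
    \forall y \near x, `|dlist t g x - dlist t g y| < e / 2.
  move=> ts; have cx : dlist t g @ x --> dlist t g x := c t ts x Ux.
  by move/cvgr_dist_lt : cx => /(_ _ e20).
have c1 := near_dlist s (leqnn _).
have c2 : \forall y \near x, `|dlist s' g x - dlist s' g y| < e / 2.
  by apply: near_dlist; rewrite ss'.
have : \forall y \near x, (`|dlist s g x - dlist s g y| < e / 2 /\
    `|dlist s' g x - dlist s' g y| < e / 2) /\ U y.
  by apply: filterI; [exact: filterI|exact: open_nbhs_nbhs].
move=> /nbhs_ballP[r /= r0 xr].
(* All points within [(size s) * h] of [x] then lie in the ball of radius [r]; the successor avoids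
   a zero denominator for the empty word. *)
pose h := r / 2 / (size s).+1%:R.
have h0 : 0 < h by rewrite !divr_gt0.
have hr : (size s)%:R * h < r.
  rewrite /h mulrA ltr_pdivrMr// mulrC; apply: ltr_pM.
  - exact: divr_ge0 (ltW r0) _.
  - by [].
  - by rewrite ltr_pdivrMr// ltr_pMr// ltr1n.
  - by rewrite ltr_nat.
have Ur y : `|y - x| <= (size s)%:R * h -> ball x r y.
  by move=> yx; rewrite -ball_normE /ball_/= distrC (le_lt_trans yx).
have UU y : `|y - x| <= (size s)%:R * h -> U y by move=> /Ur /xr[].
have [xi xix E1] := fdiffs_mean_value oU h0 Cg UU.
rewrite ss' in Cg UU.
have [xi' xix' E2] := fdiffs_mean_value oU h0 Cg UU.
rewrite -ss' in xix'.
have [[d1 _] _] := xr _ (Ur _ xix).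
have [[_ d2] _] := xr _ (Ur _ xix').
have E : dlist s g xi = dlist s' g xi' by rewrite -E1 -E2 (perm_fdiffs _ _ pss').
rewrite (_ : _ - _ = (dlist s g x - dlist s g xi) - (dlist s' g x - dlist s' g xi')).
  rewrite [leRHS]splitr (le_trans (ler_normB _ _))// lerD//; exact: ltW.
by rewrite E; ring.
Qed.

End finite_differences.

(** * Leibniz and Faa di Bruno formulas *)

Section splits.
Variable T : eqType.
Implicit Types (w : seq T).

(* The index set of the Leibniz rule for iterated partial derivatives. *)
Fixpoint splits w : seq (seq T * seq T) :=
  if w is i :: w' then
    [seq (i :: P.1, P.2) | P <- splits w'] ++ [seq (P.1, i :: P.2) | P <- splits w']
  else [:: ([::], [::])].

Lemma perm_splits w P : P \in splits w -> perm_eq (P.1 ++ P.2) w.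
Proof.
elim: w P => [|i w IH] P /=; first by rewrite inE => /eqP ->.
rewrite mem_cat => /orP[] /mapP[Q /IH Qw ->] /=; first by rewrite perm_cons.
by rewrite perm_catC/= perm_cons perm_catC.
Qed.

Lemma size_splits w P : P \in splits w -> (size P.1 + size P.2)%N = size w.
Proof. by move=> /perm_splits /perm_size; rewrite size_cat. Qed.

Lemma big_splits_cons (R : nmodType) i w (F : seq T * seq T -> R) :
  \sum_(P <- splits (i :: w)) F P =
  \sum_(P <- splits w) F (i :: P.1, P.2) + \sum_(P <- splits w) F (P.1, i :: P.2).
Proof. by rewrite /= big_cat !big_map. Qed.

End splits.

Section leibniz.
Variables (R : realType) (d : nat).
Local Notation Rd := ('rV[R]_d).
Implicit Types (U : set Rd) (f g : Rd -> R) (w : seq 'I_d).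

Lemma pderiv_sum (I : eqType) (r : seq I) U i (F : I -> Rd -> R) x :
  (forall j, j \in r -> Ck U 1 (F j)) -> U x ->
  pderiv i (fun y => \sum_(j <- r) F j y) x = \sum_(j <- r) pderiv i (F j) x.
Proof.
move=> CF Ux.
have dF j : j \in r -> derivable (F j) x (unitv R i).
  by move=> /CF /CkSP[_ dF _]; exact: dF.
suff [_ E] : is_derive x (unitv R i) (fun y => \sum_(j <- r) F j y)
    (\sum_(j <- r) pderiv i (F j) x) by exact: E.
elim: r {CF} dF => [|j r IH] dF.
  rewrite big_nil (_ : (fun _ => _) = cst 0); first exact: is_derive_cst.
  by apply/funext => y; rewrite big_nil.
rewrite big_cons (_ : (fun _ => _) = F j + (fun y => \sum_(j <- r) F j y)).
  apply: is_deriveD; first by apply: derivableP; apply: dF; rewrite mem_head.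
  by apply: IH => k kr; apply: dF; rewrite inE kr orbT.
by apply/funext => y; rewrite big_cons.
Qed.

Lemma pderivZ U i (a : R) g x : Ck U 1 g -> U x ->
  pderiv i (fun y => a * g y) x = a * pderiv i g x.
Proof.
move=> Cg Ux; rewrite (pderivM i (Ck_cst U 1 a) Cg Ux).
by rewrite /pderiv derive_cst mul0r add0r.
Qed.

Lemma dlistM U w f g x : open U -> Ck U (size w) f -> Ck U (size w) g -> U x ->
  dlist w (fun y => f y * g y) x =
  \sum_(P <- splits w) dlist P.1 f x * dlist P.2 g x.
Proof.
move=> oU; elim: w x => [|i w IH] x Cf Cg Ux; first by rewrite big_seq1.
have Cf' := Ck_le (leqnSn (size w)) Cf; have Cg' := Ck_le (leqnSn (size w)) Cg.
have C1 P : P \in splits w -> Ck U 1 (dlist P.1 f) /\ Ck U 1 (dlist P.2 g).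
  move=> /size_splits ss; split; apply: Ck_dlist; rewrite addn1.
    by apply: (Ck_le _ Cf); rewrite /= ltnS -ss leq_addr.
  by apply: (Ck_le _ Cg); rewrite /= ltnS -ss leq_addl.
rewrite big_splits_cons -big_split.
rewrite -[LHS]/(pderiv i (dlist w (fun y => f y * g y)) x).
rewrite (eq_pderiv i oU (fun y Uy => IH y Cf' Cg' Uy) Ux).
have CF P : P \in splits w -> Ck U 1 (fun y => dlist P.1 f y * dlist P.2 g y).
  by move=> /C1[Cf1 Cg1]; exact: (CkM oU Cf1 Cg1).
rewrite (pderiv_sum i CF Ux).
rewrite big_seq [RHS]big_seq; apply: eq_bigr => P /C1[Cf1 Cg1].
by rewrite (pderivM i Cf1 Cg1 Ux).
Qed.

(** Iterates [f * d_i u = d_i (f * u) - (d_i f) * u] with [u = dlist w g]. In the last term [d_i]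
    acts on [f] before the other derivatives, whereas the word [i :: P.1] takes it last;
    [dlist_perm] reconciles the two. *)
Lemma dlistM_inv U w f g x : open U -> Ck U (size w) f -> Ck U (size w) g -> U x ->
  f x * dlist w g x = \sum_(P <- splits w)
    (-1) ^+ size P.1 * dlist P.2 (fun y => dlist P.1 f y * g y) x.
Proof.
move=> oU; elim: w f g x => [|i w IH] f g x Cf Cg Ux.
  by rewrite big_seq1 /= expr0 mul1r.
have Cf' := Ck_le (leqnSn (size w)) Cf; have Cg' := Ck_le (leqnSn (size w)) Cg.
have Cdf : Ck U (size w) (pderiv i f) by have /CkSP[_ _ h] := Cf; exact: (h i).
have Cdg : Ck U 1 (dlist w g) by apply: Ck_dlist; rewrite addn1; exact: Cg.
have CP P : P \in splits w -> Ck U (size P.2).+1 (fun y => dlist P.1 f y * g y).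
  move=> /size_splits ss; apply: (CkM oU); last first.
    by apply: (Ck_le _ Cg); rewrite /= ltnS -ss leq_addl.
  by apply: Ck_dlist; rewrite addnS ss; exact: Cf.
have Cf1 : Ck U 1 f by exact: (Ck_le (ltn0Sn _) Cf).
have -> : f x * dlist (i :: w) g x =
    pderiv i (fun y => f y * dlist w g y) x - pderiv i f x * dlist w g x.
  by rewrite (pderivM i Cf1 Cdg Ux) addrAC subrr add0r.
rewrite (eq_pderiv i oU (fun y Uy => IH f g y Cf' Cg' Uy) Ux).
rewrite (IH _ _ _ Cdf Cg' Ux) big_splits_cons addrC; congr (_ + _).
  rewrite -sumrN big_seq [RHS]big_seq; apply: eq_bigr => P Pw /=.
  rewrite exprS -mulrA mulN1r; congr (- (_ * _)).
  apply: (eq_dlist _ oU _ Ux) => y Uy; congr (_ * _).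
  rewrite -dlist_rcons -[pderiv i _ y]/(dlist (i :: P.1) f y).
  apply: (dlist_perm oU _ _ Uy); last by rewrite perm_rcons.
  by apply: (Ck_le _ Cf); rewrite /= size_rcons ltnS -(size_splits Pw) leq_addr.
have CdP P : P \in splits w -> Ck U 1 (dlist P.2 (fun y => dlist P.1 f y * g y)).
  by move=> /CP Cw; apply: Ck_dlist; rewrite addn1; exact: Cw.
have CF P : P \in splits w -> Ck U 1
    (fun y => (-1) ^+ size P.1 * dlist P.2 (fun y => dlist P.1 f y * g y) y).
  by move=> /CdP Cw; exact: (CkM oU (Ck_cst _ _ _) Cw).
rewrite (pderiv_sum i CF Ux) big_seq [RHS]big_seq; apply: eq_bigr => P /CdP Cw.
by rewrite (pderivZ i _ Cw Ux).
Qed.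

End leibniz.

(** * Derivatives of a composition, as a sum over set partitions *)

Section faa_di_bruno.
Variables (R : realType) (d : nat).
Local Notation Rd := ('rV[R]_d).
Implicit Types (U : set Rd) (w : seq 'I_d).

(** The terms of the product rule for a product over blocks: [i] joins each block of [P] in turn. *)
Fixpoint cons_each (i : 'I_d) (P : seq (seq 'I_d)) : seq (seq (seq 'I_d)) :=
  if P is B :: P' then ((i :: B) :: P') :: [seq B :: Q | Q <- cons_each i P']
  else [::].

(* Enumerates the set partitions of the letters of a word into nonempty blocks. *)
Fixpoint blocks w : seq (seq (seq 'I_d)) :=
  if w is i :: w' then
    flatten [seq ([:: i] :: P) :: cons_each i P | P <- blocks w']
  else [:: [::]].

Lemma cons_eachP i P Q : Q \in cons_each i P ->
  [/\ size Q = size P, perm_eq (flatten Q) (i :: flatten P) &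
      ([::] \notin P -> [::] \notin Q)].
Proof.
elim: P Q => [|B P IH] Q //=; rewrite inE => /predU1P[->|/mapP[Q' /IH[sQ pQ nQ] ->]].
  by split => //=; rewrite !inE !negb_or/= => /andP[_].
split; rewrite /= ?sQ//.
  rewrite (perm_trans (y := B ++ i :: flatten P))//; first by rewrite perm_cat2l.
  by rewrite -cat1s perm_catCA.
by rewrite !inE !negb_or => /andP[-> /nQ].
Qed.

Lemma blocksP w P : P \in blocks w ->
  perm_eq (flatten P) w /\ [::] \notin P.
Proof.
elim: w P => [|i w IH] P /=; first by rewrite inE => /eqP ->.
move=> /flatten_mapP[Q /IH[pQ nQ]]; rewrite inE => /predU1P[->|/cons_eachP[_ pP nP]].
  by rewrite /= perm_cons inE negb_or.
by rewrite nP// (perm_trans pP)// perm_cons.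
Qed.

Lemma pderiv_prod_blocks U i (v : Rd -> R) (P : seq (seq 'I_d)) x : open U ->
  (forall B, B \in P -> Ck U (size B).+1 v) -> U x ->
  Ck U 1 (fun y => \prod_(B <- P) dlist B v y) /\
  pderiv i (fun y => \prod_(B <- P) dlist B v y) x =
  \sum_(Q <- cons_each i P) \prod_(B <- Q) dlist B v x.
Proof.
move=> oU CP Ux; elim: P CP => [|B P IH] CP.
  rewrite (_ : (fun _ => _) = fun=> 1); last by apply/funext => y; rewrite big_nil.
  by split; [exact: Ck_cst|rewrite big_nil; exact: derive_cst].
have [Q QP|C1 E] := IH; first by apply: CP; rewrite inE QP orbT.
have CB : Ck U 1 (dlist B v).
  by apply: Ck_dlist; rewrite addn1; apply: CP; rewrite mem_head.
rewrite (_ : (fun _ => _) = fun y => dlist B v y * \prod_(B <- P) dlist B v y); last first.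
  by apply/funext => y; rewrite big_cons.
split; first exact: (CkM oU CB C1).
rewrite (pderivM i CB C1 Ux) E /= big_cons big_cons; congr (_ + _).
by rewrite big_map mulr_sumr; apply: eq_bigr => Q _; rewrite big_cons.
Qed.

(** A new derivative along [i] either raises the order of the outer derivative, which creates the
    block [[:: i]], or hits one factor of the product, which enlarges a block. These are the two
    ways in which [blocks] treats a new letter. *)
Lemma dlist_comp U w (G : R -> R) (v : Rd -> R) x : open U -> smooth1 G ->
  Ck U (size w) v -> U x ->
  dlist w (fun y => G (v y)) x = \sum_(P <- blocks w)
    iter (size P) (@derive1 R R) G (v x) * \prod_(B <- P) dlist B v x.
Proof.
move=> oU sG; elim: w x => [|i w IH] x Cv Ux; first by rewrite big_seq1 big_nil mulr1.
have Cv' := Ck_le (leqnSn (size w)) Cv.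
have sGn n : smooth1 (iter n (@derive1 R R) G).
  by elim: n => [|n IHn]; [exact: sG|exact: (smooth1_derive IHn)].
have CG n : Ck U 1 (fun y => iter n (@derive1 R R) G (v y)).
  exact: (Ck_compR oU (sGn n) (Ck_le (ltn0Sn _) Cv)).
have CB P : P \in blocks w -> forall B, B \in P -> Ck U (size B).+1 v.
  move=> /blocksP[pP _] B BP; apply: (Ck_le _ Cv); rewrite /= ltnS -(perm_size pP).
  by case/splitPr: BP => P1 P2; rewrite flatten_cat /= !size_cat addnCA leq_addr.
rewrite -[LHS]/(pderiv i (dlist w (fun y => G (v y))) x).
rewrite (eq_pderiv i oU (fun y Uy => IH y Cv' Uy) Ux).
have CF P : P \in blocks w -> Ck U 1 (fun y =>
    iter (size P) (@derive1 R R) G (v y) * \prod_(B <- P) dlist B v y).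
  by move=> /CB CP; have [C1 _] := pderiv_prod_blocks i oU CP Ux; exact: (CkM oU (CG _) C1).
rewrite (pderiv_sum i CF Ux) [in RHS]/= big_flatten big_map big_seq [RHS]big_seq; apply: eq_bigr => P Pw.
have [C1 E] := pderiv_prod_blocks i oU (CB P Pw) Ux.
rewrite (pderivM i (CG _) C1 Ux) E big_cons /= big_cons; congr (_ + _).
  rewrite mulrA; congr (_ * _).
  apply: derive_compR; first exact: (sGn _ 0%N).
  by have /CkSP[_ h _] := Ck_le (ltn0Sn _) Cv; exact: (h i x Ux).
rewrite mulr_sumr big_seq [RHS]big_seq; apply: eq_bigr => Q /cons_eachP[-> _ _].
by [].
Qed.

End faa_di_bruno.

(** * Bounds on the derivatives of the cut-offs *)

Section words.
Variable d : nat.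
Implicit Types (w : seq 'I_d) (a b : mi d).

Definition mi_word w : mi d := [ffun i => count_mem i w].

Lemma count_mseq a i : count_mem i (mseq a) = a i.
Proof.
rewrite /mseq count_flatten -map_comp sumnE big_map big_enum/=.
rewrite (bigD1 i)//= count_nseq/= eqxx mul1n big1 ?addn0// => j ji.
by rewrite count_nseq/= (negbTE ji).
Qed.

Lemma perm_mseq w : perm_eq w (mseq (mi_word w)).
Proof. by apply/allP => i _ /=; rewrite count_mseq ffunE. Qed.

Lemma size_mseq a : size (mseq a) = mabs a.
Proof.
rewrite /mseq size_flatten /shape -map_comp sumnE big_map big_enum/=.
by apply: eq_bigr => i _; rewrite size_nseq.
Qed.

Lemma mi_word_mseq a : mi_word (mseq a) = a.
Proof. by apply/ffunP => i; rewrite ffunE count_mseq. Qed.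

Lemma mabs_mi_word w : mabs (mi_word w) = size w.
Proof. by rewrite -size_mseq -(perm_size (perm_mseq w)). Qed.

Lemma perm_mi_word w w' : perm_eq w w' -> mi_word w = mi_word w'.
Proof. by move=> /permP p; apply/ffunP => i; rewrite !ffunE. Qed.

Lemma mi_word_nil : mi_word [::] = mi0 d.
Proof. by apply/ffunP => i; rewrite !ffunE. Qed.

Lemma admissible_cat (R : realType) m (s : mi d -> R) w1 w2 : admissible m s ->
  (size w1 + size w2 <= m)%N ->
  s (mi_word w1) + s (mi_word w2) <= s (mi_word (w1 ++ w2)).
Proof.
move=> /(_ (mi_word (w1 ++ w2))); rewrite mabs_mi_word size_cat => h /h[_ _].
move=> /(_ (mi_word w2)); rewrite (_ : mi_sub _ _ = mi_word w1).
  by apply=> i; rewrite !ffunE count_cat leq_addl.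
by apply/ffunP => i; rewrite !ffunE count_cat addnK.
Qed.

Lemma admissible_ge0 (R : realType) m (s : mi d -> R) a : admissible m s ->
  (mabs a <= m)%N -> 0 <= s a.
Proof. by move=> h /h[]. Qed.

Lemma admissible0 (R : realType) m (s : mi d -> R) : admissible m s -> s (mi0 d) = 0.
Proof.
move=> /(_ (mi0 d)); rewrite (_ : mabs _ = 0%N).
  by move=> /(_ isT)[s0 s0' _]; apply/eqP; rewrite eq_le s0 s0'.
by rewrite -mi_word_nil mabs_mi_word.
Qed.

Lemma admissible_flatten (R : realType) m (s : mi d -> R) (P : seq (seq 'I_d)) :
  admissible m s -> (size (flatten P) <= m)%N ->
  \sum_(B <- P) s (mi_word B) <= s (mi_word (flatten P)).
Proof.
move=> adm; elim: P => [|B P IH] /= sm.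
  by rewrite big_nil mi_word_nil (admissible0 adm).
rewrite size_cat in sm; rewrite big_cons (le_trans _ (admissible_cat adm sm))// lerD2l.
by rewrite IH// (leq_trans _ sm)// leq_addl.
Qed.

(** The bridge from words to the multi-indices of the hypotheses, by symmetry of partial
    derivatives. *)
Lemma dlist_dpart (R : realType) (U : set 'rV[R]_d) w g x :
  open U -> Ck U (size w) g -> U x -> dlist w g x = dpart (mi_word w) g x.
Proof. by move=> oU Cg Ux; exact: (dlist_perm oU Cg (perm_mseq w) Ux). Qed.

End words.

(** * Derivatives of the cut-off profile *)

Section cutoff_profile.
Variables (R : realType) (eta : R -> R).
Hypothesis seta : smooth1 eta.
Hypothesis eta1 : forall t, 1 < `|t| -> eta t = 1.
Hypothesis eta0 : forall t, `|t| <= 2^-1 -> eta t = 0.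

Local Notation "eta ^[ k ]" := (iter k (@derive1 R R) eta) (at level 2).

Lemma iter_smooth1 k : smooth1 eta^[k].
Proof. by elim: k => [|k IH]; [exact: seta|exact: (smooth1_derive IH)]. Qed.

Lemma eq_cst_derive1 (A : set R) (c : R) (g : R -> R) : open A ->
  (forall t, A t -> g t = c) -> forall t, A t -> derive1 g t = 0.
Proof.
move=> oA gc t At; rewrite derive1E (@near_eq_derive _ _ _ _ (cst c)).
  exact: derive_cst.
by near=> y; apply: gc; near: y; exact: open_nbhs_nbhs.
Unshelve. all: by end_near. Qed.

Lemma open_norm_gt (c : R) : open [set t : R | c < `|t|].
Proof.
rewrite (_ : mkset _ = (fun t : R => `|t|) @^-1` [set t : R | c < t])//.
by apply: open_comp; [move=> t _; exact: norm_continuous|exact: open_gt].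
Qed.

Lemma open_norm_lt (c : R) : open [set t : R | `|t| < c].
Proof.
rewrite (_ : mkset _ = (fun t : R => `|t|) @^-1` [set t : R | t < c])//.
by apply: open_comp; [move=> t _; exact: norm_continuous|exact: open_lt].
Qed.

Lemma iter_derive_out k t : 1 < `|t| -> eta^[k.+1] t = 0.
Proof.
elim: k t => [|k IH] t t1.
  exact: (@eq_cst_derive1 _ 1 eta (@open_norm_gt 1) eta1 t t1).
exact: (@eq_cst_derive1 _ 0 _ (@open_norm_gt 1) IH t t1).
Qed.

(** Inside the open interval [eta] is locally constant. The end points are included because the
    hypothesis on [v] says nothing where |v| = 1/(2n); there the value is a limit from inside, by
    continuity of the derivative. *)
Lemma iter_derive_in k t : `|t| <= 2^-1 -> eta^[k] t = 0.
Proof.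
have H u : `|u| < 2^-1 -> eta^[k] u = 0.
  elim: k u => [|k IH] u u1; first by rewrite /= eta0// ltW.
  exact: (@eq_cst_derive1 _ 0 _ (@open_norm_lt 2^-1) IH u u1).
rewrite le_eqVlt => /predU1P[t2|/H//].
apply/eqP/negPn/negP => gt0.
have cg : eta^[k] @ t --> eta^[k] t by exact: (smooth1_cont (@iter_smooth1 k) (x := t)).
have gp : 0 < `|eta^[k] t| by rewrite normr_gt0.
move/cvgr_dist_lt : cg => /(_ _ gp) /nbhs_ballP[r /= r0 tr].
(* The point [(1 - q) * t] lies in the open interval, where the derivative vanishes, and closer to
   [t] than [r]. *)
pose q := Num.min r 1.
have q0 : 0 < q by rewrite lt_min r0 ltr01.
have [qr q1] : q <= r /\ q <= 1 by split; rewrite ge_min lexx ?orbT.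
have qt : `|(1 - q) * t| < 2^-1.
  by rewrite normrM t2 gtr_pMl// ger0_norm ?subr_ge0// ltrBlDr ltrDl.
have bt : ball t r ((1 - q) * t).
  rewrite /ball/= mulrBl mul1r opprB addrC subrK normrM t2 gtr0_norm//.
  by rewrite (lt_le_trans _ qr)// gtr_pMr// invf_lt1 ?ltr1n.
by have := tr _ bt; rewrite (H _ qt) subr0 ltxx.
Qed.

Lemma iter_derive_bounded k : exists E, forall t, `|eta^[k] t| <= E.
Proof.
have [||c _ cm] := @EVT_max R (fun t => `|eta^[k] t|) (-1) 1.
- by rewrite (le_trans (lerN10 _)).
- apply: continuous_subspaceT => t; apply: continuous_comp.
    exact: (smooth1_cont (@iter_smooth1 k) (x := t)).
  exact: norm_continuous.
(* The summand 1 is for [k = 0], where [eta] equals 1 outside [[-1, 1]]; the higher derivatives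
   vanish there. *)
exists (`|eta^[k] c| + 1) => t; have [t1|t1] := leP `|t| 1.
  by rewrite (le_trans (cm t _)) ?lerDl// in_itv/= -ler_norml.
case: k cm => [|k] cm; last by rewrite iter_derive_out// normr0 addr_ge0.
by rewrite /= eta1// normr1 lerDr.
Qed.

End cutoff_profile.

Lemma prod_powR (R : realType) (I : Type) (r : seq I) (F : I -> R) (C a : R) : 0 < a ->
  \prod_(i <- r) (C * powR a (F i)) = C ^+ size r * powR a (\sum_(i <- r) F i).
Proof.
move=> a0; elim: r => [|i r IH]; first by rewrite !big_nil powRr0 mulr1.
rewrite !big_cons IH /= exprS powRD; first by rewrite mulrACA.
by rewrite (gt_eqF a0) implybT.
Qed.

(** * Growth in n of the derivatives of the cut-offs *)

Section cutoff_bounds.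
Variables (R : realType) (d : nat) (Om : set 'rV[R]_d) (m : nat).
Variables (v : 'rV[R]_d -> R) (s : mi d -> R) (eta : R -> R).
Hypothesis oOm : open Om.
Hypothesis Cv : Ck Om m v.
Hypothesis adm : admissible m s.
Hypothesis seta : smooth1 eta.
Hypothesis eta01 : forall t, 0 <= eta t <= 1.
Hypothesis eta1 : forall t, 1 < `|t| -> eta t = 1.
Hypothesis eta0 : forall t, `|t| <= 2^-1 -> eta t = 0.
Variable C : R.
Hypothesis C0 : 0 < C.
Hypothesis dv : forall n : nat, (1 <= n)%N ->
  forall sigma : mi d, (0 < mabs sigma <= m)%N ->
  forall x, Om x -> `|v x| <= n%:R^-1 -> (2 * n)%:R^-1 < `|v x| ->
  `|dpart sigma v x| <= C * powR n%:R (s sigma - 1).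

Definition cutoff (n : nat) (x : 'rV[R]_d) := eta (n%:R * v x).

Lemma Ck_cutoff n : Ck Om m (cutoff n).
Proof. exact: (Ck_compR oOm seta (CkM oOm (Ck_cst _ _ _) Cv)). Qed.

Lemma dlist_scale n w x : (size w <= m)%N -> Om x ->
  dlist w (fun y => n%:R * v y) x = n%:R * dlist w v x.
Proof.
elim: w x => // i w IH x wm Omx.
have wm' := ltnW wm.
rewrite -[LHS]/(pderiv i (dlist w (fun y => n%:R * v y)) x).
rewrite (eq_pderiv i oOm (fun y Oy => IH y wm' Oy) Omx).
apply: (pderivZ i _ _ Omx); apply: Ck_dlist; rewrite addn1; exact: (Ck_le wm Cv).
Qed.

Lemma dlist_cutoffE n w x : (size w <= m)%N -> Om x ->
  dlist w (cutoff n) x = \sum_(P <- blocks w)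
    iter (size P) (@derive1 R R) eta (n%:R * v x) *
    \prod_(B <- P) (n%:R * dlist B v x).
Proof.
move=> wm Omx.
have Cnv : Ck Om (size w) (fun y => n%:R * v y).
  exact: (CkM oOm (Ck_cst _ _ _) (Ck_le wm Cv)).
rewrite (dlist_comp oOm seta Cnv Omx) big_seq [RHS]big_seq; apply: eq_bigr => P.
move=> /blocksP[pP _]; congr (_ * _); rewrite big_seq [RHS]big_seq; apply: eq_bigr => B BP.
apply: dlist_scale => //; apply: leq_trans wm; rewrite -(perm_size pP).
by case/splitPr: BP => P1 P2; rewrite flatten_cat /= !size_cat addnCA leq_addr.
Qed.

Lemma blocks_size_gt0 w (P : seq (seq 'I_d)) :
  w != [::] -> P \in blocks w -> (0 < size P)%N.
Proof.
by case: P => // wn /blocksP[/=]; rewrite perm_sym => /perm_nilP w0; rewrite w0 in wn.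
Qed.

Lemma dlist_cutoff_out n w x : (1 <= n)%N -> (size w <= m)%N -> w != [::] -> Om x ->
  n%:R^-1 < `|v x| -> dlist w (cutoff n) x = 0.
Proof.
move=> n1 wm w0 Omx vx; rewrite dlist_cutoffE// big_seq big1// => P /(blocks_size_gt0 w0).
case: (size P) => // k _; rewrite iter_derive_out ?mul0r//.
have n0 : 0 < n%:R :> R by rewrite ltr0n.
by rewrite normrM gtr0_norm// -ltr_pdivrMl// mulr1.
Qed.

Lemma dlist_cutoff_in n w x : (1 <= n)%N -> (size w <= m)%N -> Om x ->
  `|v x| <= (2 * n)%:R^-1 -> dlist w (cutoff n) x = 0.
Proof.
move=> n1 wm Omx vx; rewrite dlist_cutoffE// big1// => P _.
rewrite iter_derive_in ?mul0r//.
have n0 : 0 < n%:R :> R by rewrite ltr0n.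
by rewrite normrM gtr0_norm// -ler_pdivlMl// (le_trans vx)// natrM invfM mulrC.
Qed.

Lemma dlist_cutoff_bound w : (size w <= m)%N -> exists2 D, 0 <= D &
  forall n x, (1 <= n)%N -> Om x ->
  `|dlist w (cutoff n) x| <= D * powR n%:R (s (mi_word w)).
Proof.
move=> wm.
have /choice[E EP] := iter_derive_bounded seta eta1.
have E0 k : 0 <= E k by rewrite (le_trans _ (EP k 0)).
(* The summand 1 covers the empty word, whose derivative is the cut-off itself. *)
exists (1 + \sum_(P <- blocks w) E (size P) * C ^+ size P).
  rewrite addr_ge0// sumr_ge0// => P _.
  by rewrite mulr_ge0// exprn_ge0// ltW.
move=> n x n1 Omx.
have n1' : 1 <= n%:R :> R by rewrite ler1n.
have n0 : 0 < n%:R :> R by rewrite ltr0n.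
have [->|w0] := eqVneq w [::].
  rewrite mi_word_nil (admissible0 adm) powRr0 mulr1/= big_seq1 /=.
  rewrite expr0 mulr1; have /andP[e0 e1] := eta01 (n%:R * v x).
  by rewrite ger0_norm// (le_trans e1)// lerDl.
have [vx|vx] := ltP n%:R^-1 `|v x|.
  by rewrite (dlist_cutoff_out n1 wm w0 Omx vx) normr0 mulr_ge0 ?powR_ge0// addr_ge0//
    sumr_ge0// => P _; rewrite mulr_ge0// exprn_ge0// ltW.
have [vx2|vx2] := leP `|v x| (2 * n)%:R^-1.
  by rewrite (dlist_cutoff_in n1 wm Omx vx2) normr0 mulr_ge0 ?powR_ge0// addr_ge0//
    sumr_ge0// => P _; rewrite mulr_ge0// exprn_ge0// ltW.
rewrite dlist_cutoffE// (le_trans (ler_norm_sum _ _ _))//.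
rewrite (le_trans (y := (\sum_(P <- blocks w) E (size P) * C ^+ size P) *
   powR n%:R (s (mi_word w))))//; last by rewrite ler_wpM2r ?powR_ge0// lerDr.
rewrite mulr_suml big_seq [leRHS]big_seq; apply: ler_sum => P Pw.
have [pP nP] := blocksP Pw.
rewrite normrM -mulrA; apply: ler_pM; [exact: normr_ge0|exact: normr_ge0|exact: EP|].
rewrite normr_prod (le_trans (y := \prod_(B <- P) (C * powR n%:R (s (mi_word B)))))//.
  rewrite [leLHS]big_seq [leRHS]big_seq; apply: ler_prod => B BP; rewrite normr_ge0/=.
  have Bm : (size B <= m)%N.
    apply: leq_trans wm; rewrite -(perm_size pP).
    by case/splitPr: BP => P1 P2; rewrite flatten_cat /= !size_cat addnCA leq_addr.
  have B0 : (0 < size B)%N by case: B BP nP {Bm} => // -> .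
  rewrite normrM gtr0_norm// (dlist_dpart oOm (Ck_le Bm Cv) Omx).
  rewrite (le_trans (ler_wpM2l (ltW n0) (dv n1 _ Omx vx vx2)))//.
    by rewrite mabs_mi_word B0.
  (* Every block carries a factor [n] from [n v], which absorbs the [-1] in the exponent of the
     hypothesis. *)
  have nE : n%:R `^ s (mi_word B) = n%:R * n%:R `^ (s (mi_word B) - 1).
    rewrite -[X in _ = X * _](powRr1 (ltW n0)) -powRD; last by rewrite (gt_eqF n0) implybT.
    by rewrite addrC subrK.
  by rewrite mulrCA ler_wpM2l ?(ltW C0)// nE.
rewrite prod_powR// ler_wpM2l ?exprn_ge0 ?(ltW C0)//.
rewrite ler_powR// -(perm_mi_word pP); apply: (admissible_flatten adm).
by rewrite (perm_size pP).
Qed.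

End cutoff_bounds.

(** * Density of smooth test functions *)

Section smooth_steps.
Variable R : realType.
Implicit Types (f g S : R -> R).

Lemma eq_derive1 (A : set R) f g : open A -> (forall t, A t -> f t = g t) ->
  forall t, A t -> derive1 f t = derive1 g t.
Proof.
move=> oA fg t At; rewrite !derive1E; apply: near_eq_derive.
by near=> y; apply: fg; near: y; exact: open_nbhs_nbhs.
Unshelve. all: by end_near. Qed.

Lemma smooth1P g : smooth1 g <-> (forall t, derivable g t 1) /\ smooth1 (derive1 g).
Proof.
split=> [sg|[dg sg] [|k] t]; first by split; [exact: (sg 0%N)|exact: (smooth1_derive sg)].
  exact: dg.
by rewrite iterSr; exact: sg.
Qed.

Lemma smooth1_cst (c : R) : smooth1 (fun=> c).
Proof.
suff H k : iter k (@derive1 R R) (fun=> c) = fun=> (if k == 0%N then c else 0).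
  by move=> k t; rewrite H; exact: derivable_cst.
elim: k => //= k ->; apply/funext => t.
by rewrite derive1E; exact: derive_cst.
Qed.

Lemma smooth1_local g : (forall t, exists A f, [/\ open A, A t, smooth1 f &
  forall u, A u -> g u = f u]) -> smooth1 g.
Proof.
move=> H k t; have [A [f [oA At sf gf]]] := H t.
have E : forall u, A u -> iter k (@derive1 R R) f u = iter k (@derive1 R R) g u.
  elim: k => [|k IH] u Au; first by rewrite /= gf.
  exact: (eq_derive1 oA IH Au).
apply: near_eq_derivable (sf k t).
by near=> y; apply: E; near: y; exact: open_nbhs_nbhs.
Unshelve. all: by end_near. Qed.

Lemma derive1_shift g (a t : R) : derive1 (fun u => g (u - a)) t = derive1 g (t - a).
Proof.
by rewrite /derive1; under eq_fun do rewrite -addrA.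
Qed.

Lemma is_derive1_shift g (a t l : R) : is_derive (t - a) 1 g l ->
  is_derive t 1 (fun u => g (u - a)) l.
Proof.
move=> [dg gl]; apply: DeriveDef.
  apply/derivable1_diffP; apply: (@differentiable_comp _ _ _ _ (fun u => u - a) g).
    by apply/derivable1_diffP; have [ds _] := is_derive_shift t (1 : R) (- a); exact: ds.
  exact/derivable1_diffP.
by rewrite -derive1E derive1_shift derive1E.
Qed.

Lemma smooth1_shift g (a : R) : smooth1 g -> smooth1 (fun u => g (u - a)).
Proof.
move=> sg k t.
have -> : iter k (@derive1 R R) (fun u => g (u - a)) =
    fun u => iter k (@derive1 R R) g (u - a).
  by elim: k => // k IH; rewrite iterS IH; apply/funext => u; rewrite derive1_shift.
by have [] := is_derive1_shift (derivableP (sg k (t - a))).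
Qed.

Lemma smooth1B f g : smooth1 f -> smooth1 g -> smooth1 (fun t => f t - g t).
Proof.
move=> sf sg k t.
have -> : iter k (@derive1 R R) (fun t => f t - g t) =
    fun t => iter k (@derive1 R R) f t - iter k (@derive1 R R) g t.
  elim: k => // k IH; rewrite iterS IH; apply/funext => u /=.
  by rewrite !derive1E deriveB.
exact: derivableB.
Qed.

Lemma primitive_from0 f : continuous f -> (forall t, t <= 0 -> f t = 0) ->
  exists P : R -> R, (forall t, t <= 0 -> P t = 0) /\ forall t : R, is_derive t (1 : R) P (f t).
Proof.
move=> cf f0.
(* Starting at [-1] keeps every [t >= 0] in the interior of the interval, as the fundamental theorem
   of calculus requires; for [t < 0] the function [P] is locally 0. *)
pose P (t : R) := Rintegral (@lebesgue_measure R) `[-1, t] f.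
have P0 t : t <= 0 -> P t = 0.
  move=> t0; rewrite /P /Rintegral integral0_eq// => u /=.
  by rewrite in_itv/= => /andP[_ ut]; rewrite f0// (le_trans ut).
exists P; split => // t; have [t0|t0] := ltP t 0.
  rewrite f0 ?ltW//.
  have nP : \forall u \near t, (cst 0 : R -> R) u = P u.
    near=> u; rewrite P0//=; apply: ltW; near: u.
    by apply: open_nbhs_nbhs; split => //; exact: open_lt.
  exact: near_eq_is_derive nP (is_derive_cst _ _ _).
have t1 : t < t + 1 by rewrite ltrDl.
have [] := @continuous_FTC1 R f (BLeft (-1)) t (t + 1) t1.
- apply: continuous_compact_integrable; first exact: segment_compact.
  exact: continuous_subspaceT.
- by rewrite /= lte_fin (lt_le_trans _ t0)// ltrN10.

- exact: cf.
by move=> dP PE; apply: (DeriveDef dP); rewrite -derive1E; exact: PE.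
Unshelve. all: by end_near. Qed.

(** The transition from 0 to 1 is complete at [r + 2] because each averaging widens it by 1. The
    last clause makes unit differences of [S] nonnegative. *)
Definition smooth_step (r : nat) S :=
  [/\ smooth1 S, forall t, 0 <= S t <= 1, forall t, t <= 0 -> S t = 0,
      forall t, r%:R + 2 <= t -> S t = 1 & forall t, S (t - 1) <= S t].

Lemma is_derive_smooth1 g (t : R) : smooth1 g -> is_derive t (1 : R) g (derive1 g t).
Proof. by move=> sg; rewrite derive1E; apply: derivableP; exact: (sg 0%N). Qed.

Lemma MVT1 g g' t : (forall u : R, is_derive u (1 : R) g (g' u)) ->
  exists2 c, t - 1 <= c <= t & g t - g (t - 1) = g' c.
Proof.
move=> dg.
have t1 : t - 1 <= t by rewrite gerBl.
have cg : {within `[t - 1, t], continuous g}.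
  by apply: derivable_within_continuous => u _; case: (dg u).
have [c + ->] := MVT_segment t1 (fun u _ => dg u) cg.
by rewrite in_itv/= => ct; exists c => //; rewrite opprB addrC subrK mulr1.
Qed.

(** [S'] is the average of [S] over [[t - 1, t]], as in the recursion of B-splines, so its
    derivative is a unit difference of [S]. The bounds and the monotonicity under unit shifts come
    from the mean value theorem. *)
Lemma smooth_step_next r S : smooth_step r S ->
  exists S', smooth_step r.+1 S' /\ forall t, derive1 S' t = S t - S (t - 1).
Proof.
move=> [sS S01 S0 S1 Sm].
have [P [P0 dP]] := primitive_from0 (smooth1_cont sS) S0.
pose S' t := P t - P (t - 1).
have dS' (t : R) : is_derive t (1 : R) S' (S t - S (t - 1)).
  by apply: is_deriveB; exact: is_derive1_shift.
have S'E t : derive1 S' t = S t - S (t - 1) by rewrite derive1E; case: (dS' t).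
exists S'; split; last exact: S'E.
split.
- apply/smooth1P; split; first by move=> t; case: (dS' t).
  rewrite (_ : derive1 S' = fun t => S t - S (t - 1)); last exact/funext.
  exact: (smooth1B sS (@smooth1_shift _ 1 sS)).
- by move=> t; have [c _ E] := MVT1 t dP; rewrite /S' E.
- by move=> t t0; rewrite /S' !P0 ?subrr// (le_trans _ t0)// gerBl.
- move=> t; rewrite -natr1 => tr; have [c /andP[ct _] E] := MVT1 t dP.
  by rewrite /S' E S1// (le_trans _ ct)// lerBrDr -addrA [2 + 1]addrC addrA.
- move=> t; rewrite -subr_ge0; have [c _ ->] := MVT1 t dS'.
  by rewrite subr_ge0.
Qed.

Variable eta : R -> R.
Hypothesis seta : smooth1 eta.
Hypothesis eta01 : forall t, 0 <= eta t <= 1.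
Hypothesis eta1 : forall t, 1 < `|t| -> eta t = 1.
Hypothesis eta0 : forall t, `|t| <= 2^-1 -> eta t = 0.

(** Replacing [eta] by 0 on the negative axis keeps it smooth, as [eta] already vanishes on
    [[-1/2, 1/2]]. *)
Lemma smooth_step0 : exists S, smooth_step 0 S.
Proof.
exists (fun t => if 0 <= t then eta t else 0); split.
- apply: smooth1_local => t; have [t0|t0] := ltP 0 t.
    exists [set u | 0 < u], eta; split; [exact: open_gt|by []|exact: seta|].
    by move=> u /= u0; rewrite ltW.
  exists [set u | u < 2^-1], (fun=> 0); split; first exact: open_lt.
  - by rewrite /= (le_lt_trans t0)// invr_gt0.
  - exact: smooth1_cst.
  - by move=> u /= u2; case: ifPn => // u0; rewrite eta0// ger0_norm// ltW.
- by move=> t; case: ifPn => // _; rewrite lexx ler01.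
- move=> t t0; case: ifPn => // t0'; have -> : t = 0 by apply/eqP; rewrite eq_le t0.
  by rewrite eta0// normr0 invr_ge0.
- move=> t; rewrite add0r => t2; have t0 : 0 <= t by rewrite (le_trans _ t2).
  by rewrite t0 eta1// ger0_norm// (lt_le_trans _ t2)// ltr1n.
- move=> t; have [t1|t1] := ltP 1 t.
    have t0 : 0 <= t by rewrite ltW// (lt_trans _ t1).
    rewrite t0 (@eta1 t) ?ger0_norm//; case: ifPn => // _.
    by have /andP[] := eta01 (t - 1).
  have -> : (if 0 <= t - 1 then eta (t - 1) else 0) = 0.
    case: ifPn => //; rewrite subr_ge0 => t1'.
    have -> : t = 1 by apply/eqP; rewrite eq_le t1.
    by rewrite subrr eta0// normr0 invr_ge0.
  by case: ifPn => // _; have /andP[] := eta01 t.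
Qed.

Lemma smooth_steps K : exists S : nat -> R -> R,
  (forall r, (r <= K)%N -> smooth_step r (S r)) /\
  (forall r t, (r < K)%N -> derive1 (S r.+1) t = S r t - S r (t - 1)).
Proof.
elim: K => [|K [S [sS dS]]].
  have [S sS] := smooth_step0; exists (fun=> S); split => [r|r t].
    by rewrite leqn0 => /eqP ->; exact: sS.
  by rewrite ltn0.
have [S' [sS' dS']] := smooth_step_next (sS K (leqnn K)).
exists (fun r => if (r <= K)%N then S r else S'); split => [r|r t].
  by rewrite leq_eqVlt => /predU1P[->|rK]; [rewrite ltnn|rewrite -ltnS rK; exact: sS].
rewrite ltnS => rK; rewrite rK; move: rK; rewrite leq_eqVlt => /predU1P[->|rK].
  by rewrite ltnn.
by rewrite rK dS.
Qed.

(** Unit differences of the steps, a smooth analogue of B-splines: integer translates telescope to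
    [S r t - S r (t - N)], hence a partition of unity away from the ends, and the difference
    relation passes from steps to kernels. The support bound [K + 3] is the transition width [K + 2]
    plus the unit shift. *)
Lemma kernels K : exists rho : nat -> R -> R, [/\
  forall r, (r <= K)%N -> smooth1 (rho r),
  forall r t, (r <= K)%N -> 0 <= rho r t,
  forall r t, (r <= K)%N -> (t <= 0) || (K%:R + 3 <= t) -> rho r t = 0,
  forall r t, (r < K)%N -> derive1 (rho r.+1) t = rho r t - rho r (t - 1) &
  forall r t (N : nat), (r <= K)%N ->
    \sum_(z < N) rho r (t - z%:R) <= 1 /\
    (K%:R + 2 <= t <= N%:R -> \sum_(z < N) rho r (t - z%:R) = 1)].
Proof.
have [S [sS dS]] := smooth_steps K.
exists (fun r t => S r t - S r (t - 1)); split.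
- move=> r rK; have [s1 _ _ _ _] := sS r rK.
  exact: (smooth1B s1 (@smooth1_shift _ 1 s1)).
- by move=> r t rK; have [_ _ _ _ Sm] := sS r rK; rewrite subr_ge0.
- move=> r t rK; have [_ _ S0 S1 _] := sS r rK.
  have rK' : r%:R <= K%:R :> R by rewrite ler_nat.
  move=> /orP[t0|t3]; first by rewrite !S0 ?subrr// (le_trans _ t0)// gerBl.
  by rewrite !S1 ?subrr//; lra.
- move=> r t rK; have [s1 _ _ _ _] := sS r.+1 rK.
  have := is_deriveB (is_derive_smooth1 t s1)
    (is_derive1_shift (is_derive_smooth1 (t - 1) s1)).
  by rewrite !dS// derive1E => -[_ ->].
- move=> r t N rK; have [_ S01 S0 S1 _] := sS r rK.
  have -> : \sum_(z < N) (S r (t - z%:R) - S r (t - z%:R - 1)) = S r t - S r (t - N%:R).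
    elim: N => [|N IH]; first by rewrite big_ord0 subr0 subrr.
    rewrite big_ord_recr IH/= addrA subrK -natr1 opprD addrA; ring.
  have rK' : r%:R <= K%:R :> R by rewrite ler_nat.
  split; first by have /andP[_ a] := S01 t; have /andP[b _] := S01 (t - N%:R); lra.
  by move=> /andP[t2 tN]; rewrite S1 ?S0 ?subr0// ?subr_le0//; lra.
Qed.

End smooth_steps.

Lemma is_derive_affine (R : realType) (a b t : R) :
  is_derive t (1 : R) (fun k => k * a + b) a.
Proof.
have [dd E] := is_deriveD (is_deriveM (is_derive_id t (1 : R))
  (is_derive_cst a t (1 : R))) (is_derive_cst b t (1 : R)).
apply: (DeriveDef dd); apply: (etrans E).
by rewrite scaler0 add0r addr0 [_ *: 1]mulr1.
Qed.

(** * Quasi-interpolation on a grid *)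

Section quasi_interpolation.
Variables (R : realType) (d : nat).
Local Notation Rd := ('rV[R]_d).
Local Notation e_ := (@unitv R d).
Variables (K : nat) (rho : nat -> R -> R).
Hypothesis srho : forall r, (r <= K)%N -> smooth1 (rho r).
Hypothesis rho_ge0 : forall r t, (r <= K)%N -> 0 <= rho r t.
Hypothesis rho0 : forall r t, (r <= K)%N -> (t <= 0) || (K%:R + 3 <= t) -> rho r t = 0.
Hypothesis drho : forall r t, (r < K)%N -> derive1 (rho r.+1) t = rho r t - rho r (t - 1).
Hypothesis sum_rho : forall r t (N : nat), (r <= K)%N ->
    \sum_(z < N) rho r (t - z%:R) <= 1 /\
    (K%:R + 2 <= t <= N%:R -> \sum_(z < N) rho r (t - z%:R) = 1).

Lemma Ck_coord k (i : 'I_d) : Ck setT k (fun x : Rd => x 0 i).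
Proof.
have d1 j (x : Rd) : is_derive x (e_ j) (fun x : Rd => x 0 i) ((e_ j) 0 i).
  have E : (fun h : R => (h *: e_ j + x) 0 i) = (fun h => h * (e_ j) 0 i + x 0 i).
    by apply/funext => h; rewrite !mxE.
  have [dl le] := is_derive_affine ((e_ j) 0 i) (x 0 i) 0.
  apply: DeriveDef; first by apply/derivable_line; rewrite E.
  by rewrite derive_line E derive1E.
case: k => [|k].
  by apply/Ck0P => x _; exact: coord_continuous.
apply/CkSP; split.
- by move=> x _; exact: coord_continuous.
- by move=> j x _; have [] := d1 j x.
- move=> j; rewrite (_ : pderiv j _ = fun=> (e_ j) 0 i); first exact: Ck_cst.
  by apply/funext => x; have [_ E] := d1 j x; exact: E.
Qed.

Lemma Ck_prod (I : Type) (r : seq I) (U : set Rd) k (F : I -> Rd -> R) : open U ->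
  (forall i, Ck U k (F i)) -> Ck U k (fun x => \prod_(i <- r) F i x).
Proof.
move=> oU CF; elim: r => [|i r IH].
  by apply: (eq_Ck oU _ (Ck_cst U k 1)) => x _; rewrite big_nil.
by apply: (eq_Ck oU _ (CkM oU (CF i) IH)) => x _; rewrite big_cons.
Qed.

Variables (M : nat) (h : R).
Hypothesis h0 : 0 < h.
Local Notation N := (2 * M)%N.
Local Notation node_idx := {ffun 'I_d -> 'I_N.+1}.
Implicit Types (z : node_idx) (c : 'I_d -> nat) (phi : Rd -> R).

Definition node z : Rd := \row_i (h * ((z i)%:R - M%:R)).

(** Grid coordinates, in which the node of index [z] is [z] itself. *)
Definition lcoord (x : Rd) (i : 'I_d) : R := x 0 i / h + M%:R.

(** The centre [z] is a real vector and not a grid index because differentiation shifts it by one,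
    possibly off the grid. *)
Definition kernel c (z : 'I_d -> R) (x : Rd) : R :=
  \prod_(i < d) rho (c i) (lcoord x i - z i).

Definition zR z (i : 'I_d) : R := (z i)%:R.

(* The kernels form a partition of unity, and differentiating [quasi phi] amounts
   to lowering the order of a kernel and replacing [phi] by a difference quotient. *)
Definition quasi c phi (x : Rd) : R := \sum_z phi (node z) * kernel c (zR z) x.

Lemma Ck_kernel_factor r (i : 'I_d) (a : R) k : (r <= K)%N ->
  Ck setT k (fun x => rho r (lcoord x i - a)).
Proof.
move=> rK.
have Cl : Ck setT k (fun x : Rd => lcoord x i - a).
  have := CkD openT (CkM openT (Ck_coord k i) (Ck_cst _ _ h^-1)) (Ck_cst setT k (M%:R - a)).
  by apply: eq_Ck; [exact: openT|move=> x _; rewrite /lcoord addrA].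
exact: (Ck_compR openT (srho rK) Cl).
Qed.

Lemma Ck_quasi c phi k : (forall i, (c i <= K)%N) -> Ck setT k (quasi c phi).
Proof.
move=> cK; apply: (Ck_sum _ openT) => z.
apply: (CkM openT (Ck_cst _ _ _)); apply: (Ck_prod _ openT) => i.
exact: Ck_kernel_factor.
Qed.

Lemma pderiv_kernel c (u : 'I_d -> R) i (x : Rd) : (forall l, (c l <= K)%N) -> (0 < c i)%N ->
  pderiv i (kernel c u) x =
  h^-1 * (kernel (fun l => (c l - (l == i))%N) u x -
          kernel (fun l => (c l - (l == i))%N) (fun l => u l + (l == i)%:R) x).
Proof.
move=> cK ci.
pose A := \prod_(l < d | l != i) rho (c l) (lcoord x l - u l).
have E : (fun k : R => kernel c u (k *: e_ i + x)) =
    (fun k => rho (c i) (k / h + (lcoord x i - u i)) * A).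
  apply/funext => k; rewrite /kernel (bigD1 i)//=; congr (rho _ _ * _).
    by rewrite /lcoord !mxE !eqxx/=; ring.
  apply: eq_bigr => l li; congr rho; rewrite /lcoord !mxE (negbTE li) andbF.
  by rewrite mulr0 add0r.
have sr := srho (cK i).
have c1K : (c i - 1 < K)%N by rewrite subn1 prednK.
have dr : is_derive (0 : R) (1 : R) (fun k => rho (c i) (k / h + (lcoord x i - u i)))
    (h^-1 * (rho (c i - 1) (lcoord x i - u i) - rho (c i - 1) (lcoord x i - u i - 1))).
  have [ea va] := is_derive_affine h^-1 (lcoord x i - u i) 0.
  have dc := derive1_comp ea (sr 0%N _).
  apply: DeriveDef.
    apply/derivable1_diffP; apply: differentiable_comp; first exact/derivable1_diffP.
    by apply/derivable1_diffP; exact: (sr 0%N).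
  rewrite -derive1E [LHS]dc (derive1E _ 0) va mul0r add0r mulrC; congr (_ * _).
  by rewrite -(drho _ c1K) subn1 (prednK ci).
have [_ E2] := is_deriveM dr (is_derive_cst A (0 : R) (1 : R)).
rewrite /pderiv derive_line E derive1E.
apply: (etrans E2); rewrite scaler0 add0r [_ *: _]mulrC -mulrA; congr (_ * _).
have K1 : kernel (fun l => (c l - (l == i))%N) u x =
    rho (c i - 1) (lcoord x i - u i) * A.
  rewrite /kernel (bigD1 i)//= eqxx; congr (_ * _).
  by apply: eq_bigr => l li; rewrite (negbTE li) subn0.
have K2 : kernel (fun l => (c l - (l == i))%N) (fun l => u l + (l == i)%:R) x =
    rho (c i - 1) (lcoord x i - u i - 1) * A.
  rewrite /kernel (bigD1 i)//= eqxx; congr (_ * _).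
    by congr rho; rewrite opprD addrA.
  by apply: eq_bigr => l li; rewrite (negbTE li) subn0 addr0.
by rewrite K1 K2 mulrBl.
Qed.

Definition vanishes_out (A : R) phi := forall y : Rd, (exists i, A <= `|y 0 i|) -> phi y = 0.

Lemma vanishes_fdiff A phi i : vanishes_out A phi -> vanishes_out (A + h) (fdiff h i phi).
Proof.
move=> vphi y [j yj]; rewrite /fdiff !vphi ?subrr ?mulr0//.
  exists j; rewrite !mxE.
  rewrite eqxx/=; set a := _%:R.
  have ha : `|h * a| <= h.
    by rewrite normrM (gtr0_norm h0) ler_piMr ?(ltW h0)// /a normr_nat lern1 leq_b1.
  rewrite -(lerD2r h) (le_trans yj)//.
  by rewrite -{1}(subrK (h * a) (y 0 j)) (le_trans (ler_normD _ _))// lerD2l.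
by exists j; rewrite (le_trans _ yj)// lerDl ltW.
Qed.

(** A cyclic shift is a bijection of the finite grid, so sums can be reindexed by it; the layer that
    wraps around lies where [phi] vanishes. *)
Definition shift_node i z : node_idx := [ffun l => if l == i then ordS (z i) else z l].

Lemma shift_node_inj i : injective (shift_node i).
Proof.
move=> z z' /ffunP zz'; apply/ffunP => l; have := zz' l; rewrite !ffunE.
have [->|//] := eqVneq l i; exact: (can_inj (@ordSK _)).
Qed.

Lemma quasi_shift A c phi i x : vanishes_out A phi -> A <= h * M%:R ->
  \sum_z phi (node z) * kernel c (fun l => zR z l + (l == i)%:R) x =
  quasi c (fun y => phi (y - h *: e_ i)) x.
Proof.
move=> vphi AM; rewrite /quasi [RHS](reindex_inj (@shift_node_inj i)).
have NM : N%:R = M%:R + M%:R :> R by rewrite -natrD addnn -mul2n.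
apply: eq_bigr => z _; have [zi|zi] := ltnP (z i).+1 N.+1.
  have szi : ordS (z i) = (z i).+1 :> nat by rewrite /= modn_small.
  congr (phi _ * _).
    apply/rowP => l; rewrite !mxE ffunE; have [->|li] := eqVneq l i.
      by rewrite szi -natr1 !eqxx/=; ring.
    by rewrite andbF mulr0 subr0.
  apply: eq_bigr => l _; congr (rho _ (_ - _)); rewrite /zR ffunE.
  have [->|li] := eqVneq l i.
    by rewrite szi -natr1.
  by rewrite addr0.
have ziN : z i = N :> nat by apply/eqP; rewrite eqn_leq -ltnS ltn_ord -ltnS.
have szi : ordS (z i) = 0%N :> nat by rewrite /= ziN modnn.
(* At the wrap the two arguments of [phi] have i-th coordinates [h M] and [- h M - h], both outside
   the box. *)
rewrite !vphi ?mul0r//; exists i.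
  rewrite !mxE ffunE eqxx szi eqxx/= sub0r mulr1 mulrN -opprD normrN ger0_norm.
    by rewrite (le_trans AM)// lerDl ltW.
  by rewrite addr_ge0// ?(ltW h0)// mulr_ge0// ltW.
by rewrite !mxE ziN NM addrK ger0_norm// mulr_ge0// ltW.
Qed.

(** Summation by parts: the unit difference of kernels produced by the derivative is moved onto the
    values of [phi]. *)
Lemma pderiv_quasi A c phi i x : (forall l, (c l <= K)%N) -> (0 < c i)%N ->
  vanishes_out A phi -> A <= h * M%:R ->
  pderiv i (quasi c phi) x = quasi (fun l => (c l - (l == i))%N) (fdiff h i phi) x.
Proof.
move=> cK ci vphi AM.
have Ck1 z : Ck setT 1 (kernel c (zR z)).
  by apply: (Ck_prod _ openT) => l; exact: Ck_kernel_factor.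
have CF z : z \in index_enum node_idx -> Ck setT 1 (fun x => phi (node z) * kernel c (zR z) x).
  by move=> _; exact: (CkM openT (Ck_cst _ _ _) (Ck1 z)).
rewrite /quasi (pderiv_sum i CF (I : setT x)).
under eq_bigr do rewrite (pderivZ i _ (Ck1 _) (I : setT x)) pderiv_kernel//.
set c' := fun l => (c l - (l == i))%N.
transitivity (h^-1 * (\sum_z phi (node z) * kernel c' (zR z) x -
    \sum_z phi (node z) * kernel c' (fun l => zR z l + (l == i)%:R) x)).
  rewrite -sumrB mulr_sumr; apply: eq_bigr => z _; ring.
rewrite (quasi_shift _ _ _ vphi AM) -sumrB mulr_sumr; apply: eq_bigr => z _.
by rewrite /fdiff; ring.
Qed.

Lemma dlist_quasi A phi w : vanishes_out A phi -> (size w <= K)%N ->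
  A + K%:R * h <= h * M%:R ->
  vanishes_out (A + (size w)%:R * h) (fdiffs h w phi) /\
  forall x, dlist w (quasi (fun=> K) phi) x =
    quasi (fun l => (K - count_mem l w)%N) (fdiffs h w phi) x.
Proof.
move=> vphi; elim: w => [|i w IH] wK AM.
  rewrite mul0r addr0; split => // x.
  by congr quasi; apply/funext => l; rewrite subn0.
have [v1 E1] := IH (ltnW wK) AM; split.
  by rewrite [fdiffs _ _ _]/= -natr1 mulrDl mul1r addrA; exact: vanishes_fdiff.
move=> x; rewrite /= (_ : dlist w _ = quasi (fun l => (K - count_mem l w)%N) (fdiffs h w phi));
  last exact/funext.
rewrite (pderiv_quasi _ _ _ v1).
- by congr quasi; apply/funext => l /=; rewrite [l == i]eq_sym addnC subnDA.
- by move=> l; rewrite leq_subr.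
- by rewrite subn_gt0 (leq_ltn_trans (count_size _ _)).
- rewrite (le_trans _ AM)// lerD2l ler_wpM2r ?(ltW h0)// ler_nat.
  exact: ltnW.
Qed.

(** The kernels are nonnegative weights of total at most 1, and only nodes within [(K + 3) h] of [x]
    have nonzero weight. A total of exactly 1 is needed to reproduce a nonzero [a], hence the
    alternative: near the edge of the grid the total may drop, but there [a] will be 0. *)
Lemma quasi_near c psi (a eps : R) (x : Rd) : (forall l, (c l <= K)%N) -> 0 <= eps ->
  (forall z, (forall i, `|node z 0 i - x 0 i| <= (K%:R + 3) * h) ->
    `|psi (node z) - a| <= eps) ->
  (a = 0 \/ forall i, K%:R + 2 <= lcoord x i <= N.+1%:R) ->
  `|quasi c psi x - a| <= eps.
Proof.
move=> cK e0 near_a ax.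
pose W z := kernel c (zR z) x.
have W0 z : 0 <= W z by apply: prodr_ge0 => l _; exact: rho_ge0.
have sW : \sum_z W z = \prod_(i < d) \sum_(k < N.+1) rho (c i) (lcoord x i - k%:R).
  by rewrite bigA_distr_bigA.
have sW1 : \sum_z W z <= 1.
  rewrite sW; apply: prodr_ile1 => i; rewrite sumr_ge0/=.
    by have [] := sum_rho (lcoord x i) N.+1 (cK i).
  by move=> k _; exact: rho_ge0.
have aE : a = \sum_z a * W z.
  case: ax => [->|ax]; first by rewrite big1// => z _; rewrite mul0r.
  rewrite -mulr_sumr sW big1 ?mulr1// => i _.
  by have [_ h1] := sum_rho (lcoord x i) N.+1 (cK i); exact/h1/ax.
rewrite {1}aE -sumrB (le_trans (ler_norm_sum _ _ _))//.
rewrite (le_trans (y := \sum_z eps * W z))//; last first.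
  by rewrite -mulr_sumr ler_piMr.
apply: ler_sum => z _; rewrite -mulrBl normrM (ger0_norm (W0 z)).
have [->|Wz] := eqVneq (W z) 0; first by rewrite !mulr0.
rewrite ler_wpM2r//; apply: near_a => i.
have zi : 0 < lcoord x i - zR z i < K%:R + 3.
  apply: contraTT Wz => Nz; rewrite negbK /W /kernel (bigD1 i)//= rho0 ?mul0r//.
  by move: Nz; rewrite negb_and -!leNgt.
have -> : node z 0 i - x 0 i = - (h * (lcoord x i - zR z i)).
  by rewrite !mxE /lcoord /zR; field; rewrite gt_eqF.
have /andP[zi0 zi1] := zi.
by rewrite normrN normrM !gtr0_norm// mulrC ler_pM2r// ltW.
Qed.

End quasi_interpolation.

(** * Uniformity over compact sets *)

Section compact_supports.
Variables (R : realType) (d : nat).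
Local Notation Rd := ('rV[R]_d).
Implicit Types (A U : set Rd) (g : Rd -> R).

Lemma compact_near_uniform A (P : R -> Rd -> Prop) : compact A ->
  (forall x, A x -> exists2 r, 0 < r &
    forall x' e, ball x r x' -> 0 < e -> e < r -> P e x') ->
  \forall e \near 0^'+, forall x, A x -> P e x.
Proof.
move=> /compact_near_coveringP cA H.
apply: (cA R (0^'+) P) => x /H[r r0 h].
exists (ball x r, [set e | 0 < e < r]) => /=.
  split; first exact: nbhsx_ballx.
  by near=> e; apply/andP; split; near: e; [exact: nbhs_right_gt|exact: nbhs_right_lt].
by move=> [x' e] /= [xx' /andP[e0 er]]; exact: h.
Unshelve. all: by end_near. Qed.

Lemma compact_supp_unif_cont A g (eps : R) : compact A -> continuous g ->
  (forall x, ~ A x -> g x = 0) -> 0 < eps ->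
  \forall e \near 0^'+, forall x y, `|y - x| <= e -> `|g y - g x| <= eps.
Proof.
move=> cA cg g0 eps0.
have H : \forall e \near 0^'+, forall x, A x -> forall y, `|y - x| <= e -> `|g y - g x| <= eps.
  apply: compact_near_uniform => // x Ax.
  have e20 : 0 < eps / 2 by rewrite divr_gt0.
  have : \forall y \near x, `|g x - g y| < eps / 2.
    have cgx : g @ x --> g x := cg x.
    by move/cvgr_dist_lt : cgx => /(_ _ e20).
  move=> /nbhs_ballP[r /= r0 xr].
  exists (r / 2); first by rewrite divr_gt0.
  move=> x' e xx' e0 er y yx'.
  have gx' : `|g x - g x'| < eps / 2.
    by apply: xr; apply: le_ball xx'; rewrite ler_pdivrMr// ler_pMr// ler1n.
  have gy : `|g x - g y| < eps / 2.
    apply: xr; rewrite [r]splitr; apply: ball_triangle xx' _.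
    by rewrite -ball_normE /ball_/= distrC (le_lt_trans yx').
  have -> : g y - g x' = (g x - g x') - (g x - g y) by ring.
  by rewrite [eps]splitr (le_trans (ler_normB _ _))// lerD// ltW.
apply: filterS H => e H x y yx.
have [Ax|Ax] := pselect (A x); first exact: H.
have [Ay|Ay] := pselect (A y); last by rewrite !g0// subrr normr0 ltW.
by rewrite distrC H// distrC.
Qed.

(** One [e] serves all words of length at most [k]: the induction removes the last letter, which
    ranges over the finite type ['I_d]. *)
Lemma dlist_unif_cont A k g (eps : R) : compact A -> Ck setT k g ->
  (forall x, ~ A x -> g x = 0) -> 0 < eps ->
  \forall e \near 0^'+, forall w, (size w <= k)%N ->
    forall x y, `|y - x| <= e -> `|dlist w g y - dlist w g x| <= eps.
Proof.
move=> cA Cg g0 eps0; elim: k g Cg g0 => [|k IH] g Cg g0.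
  have cg : continuous g by move=> x; exact: (Ck_cont Cg).
  have := compact_supp_unif_cont cA cg g0 eps0; apply: filterS => e He w.
  by rewrite leqn0 size_eq0 => /eqP ->.
have cg : continuous g by move=> x; exact: (Ck_cont Cg).
have /CkSP[_ _ Cdg] := Cg.
have dg0 i x : ~ A x -> pderiv i g x = 0.
  move=> Ax; apply: (dlist_supp [:: i] _ g0 Ax).
  by apply: compact_closed => //; exact: norm_hausdorff.
have H0 := compact_supp_unif_cont cA cg g0 eps0.
have H1 : \forall e \near 0^'+, forall i w, (size w <= k)%N ->
    forall x y, `|y - x| <= e -> `|dlist w (pderiv i g) y - dlist w (pderiv i g) x| <= eps.
  by apply: filter_forall => i; apply: IH; [exact: Cdg|exact: dg0].
near=> e => w; case/lastP: w => [_|w i]; first by near: e.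
by rewrite size_rcons !dlist_rcons ltnS; move: i w; near: e.
Unshelve. all: by end_near. Qed.

Lemma compact_norm_bound A : compact A -> exists B, forall x, A x -> `|x| < B.
Proof.
move=> /compact_bounded[M [_ HM]]; exists (M + 2) => x Ax.
by rewrite (le_lt_trans (HM (M + 1) _ x Ax)) ?ltrDl// ltrD2l ltr1n.
Qed.

Lemma compact_thicken A U : open U -> compact A -> A `<=` U ->
  exists2 e, 0 < e & exists B, [/\ compact B, B `<=` U &
    forall x y, A x -> `|y - x| <= e -> B y].
Proof.
move=> oU cA AU.
have : \forall e \near 0^'+, forall x, A x -> forall y, `|y - x| <= e -> U y.
  apply: compact_near_uniform => // x /AU Ux.
  have /nbhs_ballP[r /= r0 xr] : nbhs x U by exact: open_nbhs_nbhs.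
  exists (r / 2); first by rewrite divr_gt0.
  move=> x' e xx' e0 er y yx'; apply: xr; rewrite [r]splitr; apply: ball_triangle xx' _.
  by rewrite -ball_normE /ball_/= distrC (le_lt_trans yx').
have e_gt0 : \forall e \near (0 : R)^'+, 0 < e by exact: nbhs_right_gt.
move=> /(filterI e_gt0) /filter_ex[e [e0 eU]].
have e20 : 0 < e / 2 by rewrite divr_gt0.
have [b Ab] := compact_norm_bound cA.
(* Points of the closure of this e/2-neighbourhood are within [e] of [A], hence still in [U]. *)
pose S := [set y : Rd | exists2 x, A x & `|y - x| <= e / 2].
have cS y : closure S y -> exists2 x, A x & `|y - x| <= e.
  move=> /(_ _ (nbhsx_ballx y _ e20))[z [[x Ax zx] yz]].
  exists x => //; rewrite -(subrKA z) [e]splitr (le_trans (ler_normD _ _))// lerD//.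
  by move: yz; rewrite -ball_normE => /ltW.
exists (e / 2) => //; exists (closure S); split.
- apply: bounded_closed_compact; last exact: closed_closure.
  exists (b + e); split => [|B bB y /cS[x Ax yx]]; first exact: num_real.
  rewrite /= (le_trans _ (ltW bB))// -(subrK x y) addrC (le_trans (ler_normD _ _))// lerD//.
  exact: ltW (Ab _ Ax).
- by move=> y /cS[x Ax yx]; exact: eU Ax _ yx.
- by move=> x y Ax yx; apply: subset_closure; exists x.
Qed.

End compact_supports.

Section density.
Variables (R : realType) (d : nat) (eta : R -> R).
Hypothesis seta : smooth1 eta.
Hypothesis eta01 : forall t, 0 <= eta t <= 1.
Hypothesis eta1 : forall t, 1 < `|t| -> eta t = 1.
Hypothesis eta0 : forall t, `|t| <= 2^-1 -> eta t = 0.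
Local Notation Rd := ('rV[R]_d).

(** [B] precedes [eps], so that a sequence of approximations has a common compact support, as
    dominated convergence will require. The derivatives of [quasi] combine difference quotients of
    [phi] at nearby nodes, each equal to a derivative of [phi] at a nearby point. *)
Lemma smooth_dense (U A : set Rd) k (phi : Rd -> R) : open U -> compact A -> A `<=` U ->
  Ck setT k phi -> (forall x, ~ A x -> phi x = 0) ->
  exists B, [/\ compact B, B `<=` U & forall eps, 0 < eps -> exists theta : Rd -> R,
    [/\ forall n, Ck setT n theta, forall x, ~ B x -> theta x = 0 &
        forall w x, (size w <= k)%N -> `|dlist w theta x - dlist w phi x| <= eps]].
Proof.
move=> oU cA AU Cphi phi0.
have [e e0 [B [cB BU AB]]] := compact_thicken oU cA AU.
exists B; split => // eps eps0.
have [rho [srho rho_ge0 rho0 drho sum_rho]] := kernels seta eta01 eta1 eta0 k.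
have [b Ab] := compact_norm_bound cA.
have b_gt0 : 0 < `|b| + 1 by rewrite ltr_pwDr.
have H := dlist_unif_cont cA Cphi phi0 eps0.
have e_gt0 : \forall t \near (0 : R)^'+, 0 < t by exact: nbhs_right_gt.
have e_lt : \forall t \near (0 : R)^'+, t < e by exact: nbhs_right_lt.
have [t [t0 [te Ht]]] := filter_ex (filterI e_gt0 (filterI e_lt H)).
(* A node that counts at [x] is within [(k + 3) h] of [x], and the mean value point of its
   difference quotient within [k h] of the node: [(2 k + 3) h = t] in total. *)
pose h := t / (2 * k%:R + 3).
have k_ge0 : 0 <= k%:R :> R by exact: ler0n.
have k3 : 0 < 2 * k%:R + 3 :> R by lra.
have h0 : 0 < h by rewrite divr_gt0.
have ht : (2 * k%:R + 3) * h = t by rewrite /h mulrC divfK// gt_eqF.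
(* The grid exceeds the box containing [A] by [(k + 3) h]. This leaves [k h] for the differences,
   each of which enlarges the support by [h], and lets the kernels sum to 1 on the box. *)
pose M := (Num.truncn ((`|b| + 1 + (k%:R + 3) * h) / h)).+1.
have hM : `|b| + 1 + (k%:R + 3) * h <= h * M%:R.
  by rewrite -ler_pdivrMl// mulrC ltW// truncnS_gt.
have outA (y : Rd) : (exists i, `|b| + 1 <= `|y 0 i|) -> ~ A y.
  move=> [i yi] /Ab yb.
  have yi' : `|y 0 i| <= `|y| by move: i {yi}; apply/norm_rV_leP.
  have : `|b| + 1 <= `|b| by rewrite (le_trans yi)// (le_trans yi')// (le_trans (ltW yb))// ler_norm.
  by rewrite gerDl ler10.
have vphi : vanishes_out (`|b| + 1) phi by move=> y /outA /phi0.
have nodeP (z : {ffun 'I_d -> 'I_(2 * M).+1}) (x : Rd) : (forall i, `|node h z 0 i - x 0 i| <= (k%:R + 3) * h) ->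
    `|node h z - x| <= (k%:R + 3) * h.
  move=> zx; apply/norm_rV_leP => [|i]; last by have := zx i; rewrite !mxE.
  by rewrite mulr_ge0 ?(ltW h0)// addr_ge0.
exists (quasi rho M h (fun=> k) phi); split.
- by move=> n; apply: (Ck_quasi (K := k)).
- move=> x Bx; apply/eqP; rewrite -normr_le0 -[quasi _ _ _ _ _ _]subr0.
  apply: (quasi_near (K := k)) => //; last by left.
  move=> z zx; rewrite subr0 phi0 ?normr0// => Az; apply: Bx; apply: AB Az _.
  rewrite distrC (le_trans (nodeP _ _ zx))// (le_trans _ (ltW te))// -ht ler_pM2r//.
  by rewrite lerD2r ler_peMl// ler1n.
- move=> w x wk.
  have wk' : (size w)%:R <= k%:R :> R by rewrite ler_nat.
  have AM : `|b| + 1 + k%:R * h <= h * M%:R.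
    by rewrite (le_trans _ hM)// lerD2l ler_pM2r// lerDl.
  have [_ ->] := dlist_quasi srho drho h0 vphi wk AM.
  apply: (quasi_near (K := k)) => //.
  + by move=> l; rewrite leq_subr.
  + exact: ltW.
  + move=> z zx.
    have [xi xiz ->] := fdiffs_mean_value openT h0 (Ck_le wk Cphi) (fun y _ => I : setT y)
      (x := node h z).
    apply: Ht => //.
    have zx' := nodeP _ _ zx.
    rewrite -(subrKA (node h z)) (le_trans (ler_normD _ _))//.
    rewrite (le_trans (lerD xiz zx'))// -ht -mulrDl ler_pM2r//.
    lra.
  + have [|xb] := pselect (exists i, `|b| + 1 <= `|x 0 i|).
      move=> /outA Ax; left; apply: (dlist_supp w _ phi0 Ax).
      by apply: compact_closed => //; exact: norm_hausdorff.
    right => i.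
    have xi : `|x 0 i| < `|b| + 1 by rewrite ltNge; apply/negP => xi; apply: xb; exists i.
    have := xi; rewrite ltr_norml => /andP[xi1 xi2].
    have NM : (2 * M).+1%:R = M%:R + M%:R + 1 :> R by rewrite -natr1 mul2n -addnn natrD.
    have kh : 0 <= k%:R * h by rewrite mulr_ge0// ltW.
    have xh : lcoord M h x i * h = x 0 i + M%:R * h.
      by rewrite /lcoord mulrDl divfK ?gt_eqF.
    by apply/andP; split; rewrite -(ler_pM2r h0) xh ?NM; lra.
Qed.
End density.

(** * Integrability on R^d *)

Section integrals.
Variables (R : realType) (d : nat).
Local Notation Rd := ('rV[R]_d).
Local Notation bT := (borelT R d).
Variable mu : {sigma_finite_measure set bT -> \bar R}.
Hypothesis muE : forall f : bT -> \bar R, measurable_fun setT f ->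
  (forall x, 0 <= f x)%E -> (intRd f = \int[mu]_x f x)%E.
Implicit Types (A Om : set bT) (f g u : bT -> R).

Lemma measRd_restrP A g : measurable A ->
  measRd (restr A g) <-> measurable_fun A g.
Proof.
move=> mA; have mr := @measurable_restrict _ _ bT R A setT g mA measurableT.
rewrite setTI in mr; split => [h|/mr h].
  by apply/mr => _ B mB; rewrite setTI; exact: h.
by move=> B mB; have := h measurableT B mB; rewrite setTI.
Qed.

Lemma intnnE A g : measurable A -> measurable_fun A g ->
  (forall x, A x -> 0 <= g x) -> (intnn A g = \int[mu]_(x in A) (g x)%:E)%E.
Proof.
move=> mA mg g0; rewrite /intnn muE.
- rewrite [RHS]integral_mkcond; apply: eq_integral => x _.
  by rewrite /restr /patch; case: ifPn.
- apply/measurable_EFinP; move/(measRd_restrP g mA) : mg => h.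
  by move=> _ B mB; rewrite setTI; exact: h.
- by move=> x; rewrite lee_fin /restr; case: ifPn => // /set_mem /g0.
Qed.

(** Integrable or not, both sides are the difference of the integrals of the positive and negative
    parts. *)
Lemma intOE A g : measurable A -> measurable_fun A g ->
  (intO A g = \int[mu]_(x in A) (g x)%:E)%E.
Proof.
move=> mA mg; rewrite /intO integralE.
have m0 : measurable_fun A (fun=> 0 : R) by exact: measurable_cst.
rewrite !intnnE//.
- congr (_ - _)%E; apply: eq_integral => x _.
    by rewrite funeposE EFin_max.
  by rewrite funenegE EFin_max EFinN.
- by apply: measurable_maxr => //; exact: measurable_funN.
- by move=> x _; rewrite le_max lexx orbT.
- exact: measurable_maxr.
- by move=> x _; rewrite le_max lexx orbT.
Qed.

Lemma measurable_cont Om g : open (Om : set Rd) ->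
  (forall x : Rd, Om x -> {for x, continuous (g : Rd -> R)}) -> measurable_fun Om g.
Proof.
move=> oOm cg mOm; apply: (@measurability _ _ bT R Om g (@RGenOpens.G R)) => //.
  exact: RGenOpens.measurableE.
move=> _ [_ [a [b ->]] <-]; apply: borel_open.
rewrite (@openE Rd) => x [Omx gx]; apply: filterI.
  exact: open_nbhs_nbhs.
have cgx : (g : Rd -> R) @ (x : Rd) --> g x := cg x Omx.
by apply: cgx; apply: open_nbhs_nbhs; split => //; exact: interval_open.
Qed.

Lemma measurable_powR_norm A p f u : measurable_fun A f -> measurable_fun A u ->
  measurable_fun A (fun x => powR `|f x * u x| p).
Proof.
move=> mf mu'; apply: (measurableT_comp (measurable_powR p)).
by apply: measurableT_comp => //; exact: measurable_funM.
Qed.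

Lemma LpwP A p u f : measurable A -> measurable_fun A u ->
  Lpw A p u f <-> measurable_fun A f /\
    (\int[mu]_(x in A) (powR `|f x * u x| p)%:E < +oo)%E.
Proof.
move=> mA mu'.
have E : measurable_fun A f -> intnn A (fun x => powR `|f x * u x| p) =
    (\int[mu]_(x in A) (powR `|f x * u x| p)%:E)%E.
  by move=> mf; apply: intnnE => //; exact: measurable_powR_norm.
split => -[]; [move=> /(measRd_restrP f mA) mf|move=> mf];
  rewrite /finite_int -?E// => h; split => //; first exact/(measRd_restrP f mA).
Qed.

Lemma Lpw_locP Om u f : measurable Om -> measurable_fun Om u ->
  Lpw_loc Om 1 u f <-> measurable_fun Om f /\
    (forall K : set Rd, compact K -> K `<=` Om ->
       mu.-integrable K (fun x => (f x * u x)%:E)).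
Proof.
move=> mOm mu'.
have mK (K : set Rd) : compact K -> measurable (K : set bT).
  by move=> cK; apply: borel_closed; apply: compact_closed => //; exact: norm_hausdorff.
have E (K : set Rd) : measurable_fun Om f -> compact K -> K `<=` Om ->
    finite_int (intnn K (fun x => powR `|f x * u x| 1)) <->
    mu.-integrable K (fun x => (f x * u x)%:E).
  move=> mf cK KOm.
  have mfK : measurable_fun (K : set bT) f by apply: measurable_funS mf.
  have muK : measurable_fun (K : set bT) u by apply: measurable_funS mu'.
  rewrite /finite_int intnnE; [|exact: mK|exact: measurable_powR_norm|by []].
  rewrite (eq_integral (fun x => `|(f x * u x)%:E|%E)); last first.
    by move=> x _; rewrite powRr1.
  split => [h|/integrableP[]//]; apply/integrableP; split => //.
  by apply/measurable_EFinP; exact: measurable_funM.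
split => -[].
  move=> /(measRd_restrP f mOm) mf h; split => // K cK KOm.
  by apply/E => //; exact: h.
move=> mf h; split; first exact/(measRd_restrP f mOm).
by move=> K cK KOm; apply/E => //; exact: h.
Qed.

Lemma integral_sum_seq (I : eqType) (r : seq I) A (F : I -> bT -> R) : measurable A ->
  (forall i, i \in r -> mu.-integrable A (fun x => (F i x)%:E)) ->
  mu.-integrable A (fun x => (\sum_(i <- r) F i x)%:E) /\
  (\int[mu]_(x in A) (\sum_(i <- r) F i x)%:E =
    \sum_(i <- r) \int[mu]_(x in A) (F i x)%:E)%E.
Proof.
move=> mA; elim: r => [|i r IH] iF.
  split; last by rewrite big_nil integral0_eq// => x _; rewrite big_nil.
  rewrite (_ : (fun _ => _) = cst 0%E); first exact: integrable0.
  by apply/funext => x; rewrite big_nil.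
have [j jr|i1 E1] := IH; first by apply: iF; rewrite inE jr orbT.
have i0 := iF i (mem_head _ _).
have E : (fun x => (\sum_(j <- i :: r) F j x)%:E) =
    (fun x => (F i x)%:E + (\sum_(j <- r) F j x)%:E)%E.
  by apply/funext => x; rewrite big_cons EFinD.
by rewrite E big_cons -E1 -integralD//; split => //; exact: integrableD.
Qed.

End integrals.

(** * Products with bounded multipliers *)

Section integrable_multipliers.
Variables (R : realType) (d : nat).
Local Notation Rd := ('rV[R]_d).
Local Notation bT := (borelT R d).
Variable mu : {measure set bT -> \bar R}.

Lemma borel_compact (K : set Rd) : compact K -> measurable (K : set bT).
Proof.
by move=> cK; apply: borel_closed; apply: compact_closed => //; exact: norm_hausdorff.
Qed.

Lemma compact_cont_bounded (K : set Rd) (g : Rd -> R) : compact K ->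
  (forall x, K x -> {for x, continuous g}) -> exists2 M, 0 <= M & forall x, K x -> `|g x| <= M.
Proof.
move=> cK cg.
have cgK : {within K, continuous g}.
  by apply: continuous_in_subspaceT => x /set_mem; exact: cg.
have /compact_bounded[M [_ HM]] := continuous_compact cgK cK.
exists (`|M| + 1) => [|x Kx]; first by rewrite addr_ge0.
apply: (HM (`|M| + 1)); last by exists x.
by rewrite (le_lt_trans (ler_norm _))// ltrDl.
Qed.

Lemma integrable_mult_bounded (A : set bT) (q c : bT -> R) (M : R) : measurable A ->
  measurable_fun A c -> (forall x, A x -> `|c x| <= M) ->
  mu.-integrable A (fun x => (q x)%:E) -> mu.-integrable A (fun x => (q x * c x)%:E).
Proof.
move=> mA mc cM iq.
have mq : measurable_fun A q by apply/measurable_EFinP; case/integrableP : iq.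
apply: (@le_integrable _ _ _ _ _ mA _ (fun x => M%:E * (q x)%:E)%E).
- by apply/measurable_EFinP; exact: measurable_funM.
- move=> x Ax; rewrite -EFinM !abse_EFin lee_fin !normrM mulrC.
  by rewrite ler_wpM2r// (le_trans (cM x Ax))// ler_norm.
- exact: integrableZl.
Qed.

Lemma integrable_extend (A B : set bT) (h : bT -> R) : measurable A -> measurable B ->
  B `<=` A -> (forall x, ~ B x -> h x = 0) ->
  mu.-integrable B (fun x => (h x)%:E) -> mu.-integrable A (fun x => (h x)%:E).
Proof.
move=> mA mB BA h0 iB; apply/(integrable_mkcond _ mA).
move/(integrable_mkcond _ mB) : iB; congr (mu.-integrable setT _).
apply/funext => x; rewrite /patch; case: ifPn => [/set_mem Bx|/negP Bx].
  by rewrite mem_set//; exact: BA.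
by case: ifPn => // _; rewrite h0// => /mem_set.
Qed.

(** [q] is integrable on [B] only, while the integrals run over [A]; since the multipliers vanish
    off [B], a multiple of [q] cut to [B] dominates. *)
Lemma cvg_integral_mult (A B : set bT) (q : bT -> R) (c_ : nat -> bT -> R)
    (c : bT -> R) (M : R) :
  measurable A -> measurable B -> B `<=` A -> measurable_fun A q ->
  (forall n, measurable_fun A (c_ n)) -> measurable_fun A c ->
  mu.-integrable B (fun x => (q x)%:E) ->
  (forall n x, B x -> `|c_ n x| <= M) -> (forall n x, ~ B x -> c_ n x = 0) ->
  (forall x, A x -> c_ ^~ x @ \oo --> c x) ->
  mu.-integrable A (fun x => (q x * c x)%:E) /\
  (fun n => \int[mu]_(x in A) (q x * c_ n x)%:E)%E @ \oo -->
    (\int[mu]_(x in A) (q x * c x)%:E)%E.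
Proof.
move=> mA mB BA mq mc_ mc iq cM c0 cc.
have mM x : B x -> 0 <= M by move=> Bx; rewrite (le_trans _ (cM 0%N x Bx)).
(* The absolute value of [M] is taken because its sign is unknown when [B] is empty. *)
pose g x := q x * (`|M| * \1_B x).
have ig : mu.-integrable A (fun x => (g x)%:E).
  apply: (integrable_extend mA mB BA) => [x Bx|].
    by rewrite /g indicE memNset// !mulr0.
  apply: (@integrable_mult_bounded _ _ _ `|M|) => //.
    by apply: measurable_funM => //; exact: measurable_indic.
  by move=> x Bx; rewrite indicE mem_set// mulr1 normr_id.
have [] := @dominated_convergence _ _ _ mu A mA (fun n x => (q x * c_ n x)%:E)
    (fun x => (q x * c x)%:E) (fun x => `|(g x)%:E|%E).
- by move=> n; apply/measurable_EFinP; exact: measurable_funM.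
- by apply/measurable_EFinP; exact: measurable_funM.
- apply/aeW => x Ax; apply/cvg_EFin; first exact: nearW.
  by apply: cvgMr; exact: cc.
- exact: integrable_abse.
- apply/aeW => x n Ax; rewrite !abse_EFin lee_fin /g !normrM normr_id.
  rewrite ler_wpM2l//; have [Bx|Bx] := pselect (B x).
    by rewrite indicE mem_set// normr1 mulr1 (le_trans (cM n x Bx))// ler_norm.
  by rewrite c0// normr0 mulr_ge0.
- by move=> i1 _ h; split.
Qed.

End integrable_multipliers.

(** * Domination of p-th powers of finite sums *)

Section Lp_sums.
Variables (R : realType) (p : R).
Hypothesis p1 : 1 <= p.

(** Each step uses [|a + b| <= 2 max(|a|, |b|)] instead of convexity; the constant depends only on
    [p] and the length of [r]. *)
Lemma powR_sum_le (I : Type) (r : seq I) : exists2 K, 0 <= K &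
  forall F : I -> R, powR `|\sum_(i <- r) F i| p <= K * \sum_(i <- r) powR `|F i| p.
Proof.
have p0 : p != 0 by rewrite gt_eqF// (lt_le_trans _ p1).
have pge0 : 0 <= p by rewrite (le_trans _ p1).
elim: r => [|i r [K K0 HK]].
  by exists 0 => // F; rewrite !big_nil normr0 powR0// mul0r.
exists (powR 2 p * (1 + K)); first by rewrite mulr_ge0 ?powR_ge0// addr_ge0.
move=> F; rewrite !big_cons.
set a := F i; set b := \sum_(j <- r) F j; set s := \sum_(j <- r) _.
have s0 : 0 <= s by apply: sumr_ge0 => j _; exact: powR_ge0.
have ab : `|a + b| <= 2 * Num.max `|a| `|b|.
  rewrite (le_trans (ler_normD _ _))// mulr2n mulrDl mul1r lerD//.
    by rewrite le_max lexx.
  by rewrite le_max lexx orbT.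
have m0 : 0 <= Num.max `|a| `|b| by rewrite le_max normr_ge0.
have abp : powR `|a + b| p <= powR (2 * Num.max `|a| `|b|) p.
  by apply: ge0_ler_powR; rewrite ?nnegrE// mulr_ge0.
rewrite (le_trans abp)// powRM// -mulrA ler_wpM2l ?powR_ge0//.
have mp : powR (Num.max `|a| `|b|) p <= powR `|a| p + powR `|b| p.
  by rewrite /Num.max; case: ifPn => _; rewrite ?lerDr ?lerDl powR_ge0.
rewrite (le_trans mp)// mulrDr lerD//.
  by rewrite ler_peMl ?powR_ge0// lerDl.
by rewrite (le_trans (HK F))// ler_wpM2r// lerDr.
Qed.

(** [Q] is fixed before [x] and [y], so it dominates a whole sequence of functions at once. *)
Lemma Lp_dominated (d : nat) (mu : {sigma_finite_measure set (borelT R d) -> \bar R})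
    (A : set (borelT R d)) (I : eqType) (r : seq I) (q : I -> borelT R d -> R) (k : I -> R) :
  measurable A -> (forall i, 0 <= k i) ->
  (forall i, i \in r -> mu.-integrable A (fun x => (powR `|q i x| p)%:E)) ->
  exists Q : borelT R d -> R, mu.-integrable A (fun x => (Q x)%:E) /\
    forall x (y : R), `|y| <= \sum_(i <- r) k i * `|q i x| -> powR `|y| p <= Q x.
Proof.
move=> mA k0 iq; have [K K0 HK] := powR_sum_le r.
have pge0 : 0 <= p by rewrite (le_trans _ p1).
exists (fun x => K * \sum_(i <- r) powR (k i) p * powR `|q i x| p); split.
  have iF i : i \in r ->
      mu.-integrable A (fun x => (powR (k i) p * powR `|q i x| p)%:E).
    by move=> ir; have := integrableZl mA (powR (k i) p) (iq i ir).
  have [i1 _] := integral_sum_seq mA iF.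
  by have := integrableZl mA K i1.
move=> x y yx.
have E : \sum_(i <- r) powR (k i) p * powR `|q i x| p =
    \sum_(i <- r) powR `|k i * `|q i x| | p.
  by apply: eq_bigr => i _; rewrite normrM normr_id (ger0_norm (k0 i)) powRM.
rewrite E (le_trans _ (HK _))//; apply: ge0_ler_powR; rewrite ?nnegrE//.
by rewrite (le_trans yx)// ler_norm.
Qed.

End Lp_sums.

(** * Weak derivatives and cut-offs *)

Lemma cvg_sum_seq (R : realType) (I : eqType) (r : seq I) (u : I -> nat -> R) (l : I -> R) :
  (forall i, i \in r -> u i @ \oo --> l i) ->
  (fun n => \sum_(i <- r) u i n) @ \oo --> \sum_(i <- r) l i.
Proof.
elim: r => [|i r IH] ul.
  rewrite big_nil (_ : (fun _ => _) = cst 0); first exact: cvg_cst.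
  by apply/funext => n; rewrite big_nil.
rewrite big_cons (_ : (fun _ => _) = u i \+ (fun n => \sum_(j <- r) u j n)).
  by apply: cvgD; [apply: ul; rewrite mem_head|apply: IH => j jr; apply: ul; rewrite inE jr orbT].
by apply/funext => n; rewrite big_cons.
Qed.

Section weak_derivatives.
Variables (R : realType) (d : nat).
Local Notation Rd := ('rV[R]_d).
Local Notation bT := (borelT R d).
Variable mu : {sigma_finite_measure set bT -> \bar R}.
Hypothesis muE : forall f : bT -> \bar R, measurable_fun setT f ->
  (forall x, 0 <= f x)%E -> (intRd f = \int[mu]_x f x)%E.
Variables (Om : set Rd) (m : nat) (v : Rd -> R) (eta : R -> R).
Hypothesis oOm : open Om.
Hypothesis Cv : Ck Om m v.
Hypothesis seta : smooth1 eta.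
Hypothesis eta01 : forall t, 0 <= eta t <= 1.
Hypothesis eta1 : forall t, 1 < `|t| -> eta t = 1.
Hypothesis eta0 : forall t, `|t| <= 2^-1 -> eta t = 0.

Definition nonzero_set : set Rd := [set x | Om x /\ v x != 0].
Local Notation Om' := nonzero_set.

Lemma open_nonzero_set : open Om'.
Proof.
rewrite openE => x [Omx vx]; apply: filterI; first exact: open_nbhs_nbhs.
have cvx : v @ x --> v x := Ck_cont Cv Omx.
by apply: (cvx [set t | t != 0]); apply: open_nbhs_nbhs; split => //; exact: open_neq.
Qed.

Lemma nonzero_subset : Om' `<=` Om. Proof. by move=> x []. Qed.

Let oOm' := open_nonzero_set.
Let mOm : measurable (Om : set bT) := borel_open oOm.
Let Cv' k : (k <= m)%N -> Ck Om' k v.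
Proof. by move=> km; exact: (Ck_subset nonzero_subset (Ck_le km Cv)). Qed.

Lemma Ck_measurable k (g : Rd -> R) : Ck Om k g -> measurable_fun (Om : set bT) g.
Proof. by move=> Cg; apply: measurable_cont => // x Omx; exact: (Ck_cont Cg Omx). Qed.

Lemma dlist_measurable k w (g : Rd -> R) : (size w <= k)%N -> Ck Om k g ->
  measurable_fun (Om : set bT) (dlist w g).
Proof. by move=> wk [c _]; apply: measurable_cont => // x Omx; exact: (c w wk x Omx). Qed.

(** On [K] the factor [v ^+ k.+1] is bounded away from 0 and can be divided out. *)
Lemma integrable_off_zeros (K : set Rd) k (g : bT -> R) : (k <= m)%N ->
  compact K -> K `<=` Om' ->
  mu.-integrable K (fun x => (g x * v x ^+ k.+1)%:E) ->
  mu.-integrable K (fun x => (g x)%:E).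
Proof.
move=> km cK KOm' ig.
pose c x := (v x ^+ k.+1)^-1.
have Cc : Ck Om' 0 c.
  apply: (CkV oOm') => [x [_ vx]|]; first by rewrite expf_eq0/= (negbTE vx).
  by apply: (CkX _ oOm'); exact: (Cv' (leq0n _)).
have [M _ cM] := compact_cont_bounded cK (fun x Kx => Ck_cont Cc (KOm' x Kx)).
have mc : measurable_fun (K : set bT) c.
  apply: (@measurable_funS _ _ bT _ Om') => //; first exact: borel_open.
  by apply: measurable_cont => // x Ox; exact: (Ck_cont Cc Ox).
have := integrable_mult_bounded (borel_compact cK) mc cM ig.
apply: eq_integrable; first exact: borel_compact.
move=> x /set_mem /KOm' [_ vx]; rewrite /c mulfK// expf_eq0/=.
by rewrite (negbTE vx).
Qed.

Section test_extension.
Variables (a : mi d) (f g : bT -> R).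
Hypothesis am : (mabs a <= m)%N.
Local Notation k := (mabs a).
Hypothesis mf : measurable_fun (Om : set bT) f.
Hypothesis mg : measurable_fun (Om : set bT) g.
Hypothesis locf : forall K : set Rd, compact K -> K `<=` Om' ->
  mu.-integrable K (fun x => (f x)%:E).
Hypothesis locg : forall K : set Rd, compact K -> K `<=` Om' ->
  mu.-integrable K (fun x => (g x)%:E).
Hypothesis fg : forall phi, testfun Om phi ->
  intO Om (fun x => f x * dpart a (fun y => v y ^+ k.+1 * phi y) x)
  = (((-1) ^+ k)%:E * intO Om (fun x => (v x ^+ k.+1 * phi x * g x)%R))%E.

(* The weak identity only involves smooth test functions; by density it extends
   to test functions [xi] of class C^|a| supported off the zeros of [v], through
   the quotient [xi / v^(|a|+1)]. *)
Lemma weak_identity_Ck (A : set Rd) (xi : Rd -> R) : compact A -> A `<=` Om' ->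
  Ck setT k xi -> (forall x, ~ A x -> xi x = 0) ->
  [/\ mu.-integrable Om (fun x => (f x * dpart a xi x)%:E),
      mu.-integrable Om (fun x => (g x * xi x)%:E) &
      (\int[mu]_(x in Om) (f x * dpart a xi x)%:E =
       ((-1) ^+ k)%:E * \int[mu]_(x in Om) (g x * xi x)%:E)%E].
Proof.
move=> cA AOm' Cxi xi0.
pose V x := v x ^+ k.+1.
have V0 x : Om' x -> V x != 0 by move=> [_ vx]; rewrite expf_eq0/= (negbTE vx).
have CV : Ck Om k V by apply: (CkX _ oOm); exact: (Ck_le am Cv).
have CV' : Ck Om' k V by exact: (Ck_subset nonzero_subset CV).
have clA : closed A by apply: compact_closed => //; exact: norm_hausdorff.
(* Where [V] vanishes so does [xi], and the quotient is 0 as it should be. *)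
pose phi x := xi x / V x.
have phi0 x : ~ A x -> phi x = 0 by move=> Ax; rewrite /phi xi0// mul0r.
have Cphi : Ck setT k phi.
  apply: (Ck_setT oOm' clA AOm' _ phi0).
  by apply: (CkM oOm' (Ck_subset (@subsetT _ _) Cxi)); exact: (CkV oOm' V0 CV').
have [B [cB BOm' dense]] := smooth_dense seta eta01 eta1 eta0 oOm' cA AOm' Cphi phi0.
have clB : closed B by apply: compact_closed => //; exact: norm_hausdorff.
have BOm : B `<=` Om by exact: subset_trans BOm' nonzero_subset.
have /choice[th thP] (n : nat) : exists theta : Rd -> R,
    [/\ forall n, Ck setT n theta, forall x, ~ B x -> theta x = 0 &
      forall w x, (size w <= k)%N -> `|dlist w theta x - dlist w phi x| <= n.+1%:R^-1].
  by apply: dense; rewrite invr_gt0.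
have thlim w x : (size w <= k)%N -> (fun n => dlist w (th n) x) @ \oo --> dlist w phi x.
  move=> wk; apply/cvgrPdist_le => _/posnumP[e]; near=> n.
  have [_ _ /(_ w x wk)] := thP n; rewrite distrC => /le_trans; apply.
  by apply: ltW; near: n; exact: near_infty_natSinv_lt.
have Cth n : Ck setT k (th n) by have [C _ _] := thP n; exact: (C k).
have th0 n x : ~ B x -> th n x = 0 by have [_ t0 _] := thP n; exact: t0.
have CthOm n j : Ck Om j (th n).
  by have [C _ _] := thP n; exact: (Ck_subset (@subsetT _ _) (C j)).
have CVth n : Ck Om k (fun y => V y * th n y) by exact: (CkM oOm CV (CthOm n k)).
pose w := mseq a; have wk : size w = k by exact: size_mseq.
have wkk : (size w <= k)%N by rewrite wk.
have Vphi x : Om' x -> V x * phi x = xi x.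
  by move=> /V0 Vx; rewrite /phi mulrC divfK.
have Cphi' : Ck Om' k phi by exact: (Ck_subset (@subsetT _ _) Cphi).
have splitsk P : P \in splits w -> (size P.1 <= k)%N /\ (size P.2 <= k)%N.
  by move=> /size_splits; rewrite wk => <-; rewrite leq_addr leq_addl.
have dVth n x : Om' x -> dlist w (fun y => V y * th n y) x =
    \sum_(P <- splits w) dlist P.1 V x * dlist P.2 (th n) x.
  move=> Ox; have h := @dlistM _ _ Om' w V (th n) x oOm'; rewrite wk in h.
  exact: (h CV' (Ck_subset (@subsetT _ _) (Cth n)) Ox).
have dVphi x : Om' x -> dlist w xi x = \sum_(P <- splits w) dlist P.1 V x * dlist P.2 phi x.
  move=> Ox; rewrite -(eq_dlist w oOm' Vphi Ox).
  have h := @dlistM _ _ Om' w V phi x oOm'; rewrite wk in h.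
  exact: (h CV' Cphi' Ox).
have [M1 M1P] : exists M1, forall n x, B x -> `|dlist w (fun y => V y * th n y) x| <= M1.
  have /choice[D DP] (P : seq 'I_d * seq 'I_d) : exists D, P \in splits w ->
      0 <= D /\ forall x, B x -> `|dlist P.1 V x| <= D /\ `|dlist P.2 phi x| <= D.
    have [Pw|_] := boolP (P \in splits w); last by exists 0.
    have [k1 k2] := splitsk P Pw.
    have [D1 D10 D1P] := compact_cont_bounded cB (fun x Bx => CV'.1 P.1 k1 x (BOm' x Bx)).
    have [D2 D20 D2P] := compact_cont_bounded cB (fun x Bx => Cphi.1 P.2 k2 x I).
    exists (D1 + D2) => _; split=> [|x Bx]; first exact: addr_ge0.
    split; first by rewrite (le_trans (D1P x Bx))// lerDl.
    by rewrite (le_trans (D2P x Bx))// lerDr.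
  (* In Leibniz' rule the derivatives of [th n] differ from those of [phi] by at most
     [1/(n+1) <= 1], hence a bound independent of [n]. *)
  exists (\sum_(P <- splits w) D P * (D P + 1)) => n x Bx.
  rewrite (dVth n x (BOm' x Bx)) (le_trans (ler_norm_sum _ _ _))//.
  rewrite big_seq [leRHS]big_seq; apply: ler_sum => P Pw.
  have [D0 /(_ x Bx)[D1 D2]] := DP P Pw.
  have [_ _ /(_ P.2 x (splitsk P Pw).2) dth] := thP n.
  rewrite normrM ler_pM//.
  rewrite -(subrK (dlist P.2 phi x) (dlist P.2 (th n) x)) addrC.
  rewrite (le_trans (ler_normD _ _))// lerD// (le_trans dth)//.
  by rewrite invf_le1// ler1n.
have mV : measurable_fun (Om : set bT) V by exact: Ck_measurable CV.
have mth n : measurable_fun (Om : set bT) (th n) by exact: Ck_measurable (CthOm n 0%N).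
have Cxi' : Ck Om k xi by exact: (Ck_subset (@subsetT _ _) Cxi).
have [M2 _ M2P] := compact_cont_bounded cB (fun x _ => Ck_cont Cphi (I : setT x)).
have [MV _ MVP] := compact_cont_bounded cB (fun x Bx => Ck_cont CV' (BOm' x Bx)).
have notB x : Om x -> ~ Om' x -> ~ A x /\ ~ B x.
  by move=> Omx Ox; split => [/AOm'|/BOm'].
have [i1 l1] : mu.-integrable Om (fun x => (f x * dlist w xi x)%:E) /\
  (fun n => \int[mu]_(x in Om) (f x * dlist w (fun y => V y * th n y) x)%:E)%E @ \oo -->
    (\int[mu]_(x in Om) (f x * dlist w xi x)%:E)%E.
  apply: (@cvg_integral_mult _ _ mu Om B _ _ _ M1) => //.
  - exact: borel_compact.
  - by move=> n; exact: (dlist_measurable wkk (CVth n)).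
  - exact: (dlist_measurable wkk Cxi').
  - exact: locf.
  - move=> n x Bx; apply: (dlist_supp w clB _ Bx) => y By.
    by rewrite th0// mulr0.
  - move=> x Omx; have [Ox|/(notB x Omx)[Ax Bx]] := pselect (Om' x).
      rewrite (dVphi x Ox); under eq_fun do rewrite (dVth _ x Ox).
      apply: (cvg_sum_seq (u := fun P n => dlist P.1 V x * dlist P.2 (th n) x)) => P Pw.
      by apply: cvgMr; exact: (thlim _ _ (splitsk P Pw).2).
    rewrite (dlist_supp w clA xi0 Ax).
    have c0 n : dlist w (fun y => V y * th n y) x = 0.
      by apply: (dlist_supp w clB _ Bx) => y By; rewrite th0// mulr0.
    by under eq_fun do rewrite c0; exact: cvg_cst.
have [i2 l2] : mu.-integrable Om (fun x => (g x * xi x)%:E) /\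
  (fun n => \int[mu]_(x in Om) (g x * (V x * th n x))%:E)%E @ \oo -->
    (\int[mu]_(x in Om) (g x * xi x)%:E)%E.
  apply: (@cvg_integral_mult _ _ mu Om B _ _ _ (MV * (M2 + 1))) => //.
  - exact: borel_compact.
  - by move=> n; exact: measurable_funM.
  - exact: Ck_measurable Cxi'.
  - exact: locg.
  - move=> n x Bx; rewrite normrM ler_pM//; first exact: MVP.
    have [_ _ /(_ [::] x (leq0n _))/= dth] := thP n.
    rewrite -(subrK (phi x) (th n x)) addrC (le_trans (ler_normD _ _))// lerD//.
      exact: M2P.
    by rewrite (le_trans dth)// invf_le1// ler1n.
  - by move=> n x Bx; rewrite th0// mulr0.
  - move=> x Omx; have [Ox|/(notB x Omx)[Ax Bx]] := pselect (Om' x).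
      rewrite -(Vphi x Ox); apply: cvgMr.
      exact: (thlim [::] x (leq0n _)).
    rewrite (xi0 x Ax); under eq_fun do rewrite (th0 _ x Bx) mulr0.
    exact: cvg_cst.
split=> //.
have E n : (\int[mu]_(x in Om) (f x * dlist w (fun y => V y * th n y) x)%:E =
    ((-1) ^+ k)%:E * \int[mu]_(x in Om) (g x * (V x * th n x))%:E)%E.
  have tth : testfun Om (th n) by have [C t0 _] := thP n; split => //; exists B; split.
  have := fg tth; rewrite !(intOE muE)//.
  - move=> ->; congr (_ * _)%E; apply: eq_integral => x _.
    by rewrite mulrC.
  - by apply: measurable_funM => //; exact: measurable_funM.
  - by apply: measurable_funM => //; exact: (dlist_measurable wkk (CVth n)).
rewrite (funext E) in l1.
apply: (cvg_unique _ l1); first exact: ereal_hausdorff.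
exact: cvgeZl.
Unshelve. all: by end_near. Qed.

End test_extension.
End weak_derivatives.

Lemma measurable_sum_seq d (T : measurableType d) (R : realType) (A : set T) (I : eqType)
    (r : seq I) (F : I -> T -> R) :
  (forall i, i \in r -> measurable_fun A (F i)) ->
  measurable_fun A (fun x => \sum_(i <- r) F i x).
Proof.
elim: r => [|i r IH] mF.
  by rewrite (_ : (fun _ => _) = cst 0); [exact: measurable_cst|apply/funext => x; rewrite big_nil].
rewrite (_ : (fun _ => _) = F i \+ (fun x => \sum_(j <- r) F j x)).
  apply: measurable_funD; first by apply: mF; rewrite mem_head.
  by apply: IH => j jr; apply: mF; rewrite inE jr orbT.
by apply/funext => x; rewrite big_cons.
Qed.

(** Only the splitting [([::], w)] has an empty first half; it carries the term of Leibniz' rule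
    that survives in the limit. *)
Lemma sum_splits_nil (R : nmodType) (T : eqType) (w : seq T) (F : seq T -> R) :
  \sum_(P <- splits w) (if P.1 == [::] then F P.2 else 0) = F w.
Proof.
elim: w F => [|i w IH] F; first by rewrite big_seq1.
by rewrite big_splits_cons big1 ?add0r// (IH (fun u => F (i :: u))).
Qed.

Lemma mabs0 d (a : mi d) : mabs a = 0%N -> a = mi0 d.
Proof. by rewrite -size_mseq => /size0nil a0; rewrite -(mi_word_mseq a) a0 mi_word_nil. Qed.

Lemma mabs_mi0 d : mabs (mi0 d) = 0%N.
Proof. by rewrite -mi_word_nil mabs_mi_word. Qed.

(** * The product of [f] with a cut-off *)

Section cutoff_products.
Variables (R : realType) (d : nat).
Local Notation Rd := ('rV[R]_d).
Local Notation bT := (borelT R d).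
Variable mu : {sigma_finite_measure set bT -> \bar R}.
Hypothesis muE : forall f : bT -> \bar R, measurable_fun setT f ->
  (forall x, 0 <= f x)%E -> (intRd f = \int[mu]_x f x)%E.
Variables (Om : set Rd) (m : nat) (p : R) (v : Rd -> R) (s : mi d -> R) (eta : R -> R).
Hypothesis oOm : open Om.
Hypothesis p1 : 1 <= p.
Hypothesis Cv : Ck Om m v.
Hypothesis adm : admissible m s.
Hypothesis seta : smooth1 eta.
Hypothesis eta01 : forall t, 0 <= eta t <= 1.
Hypothesis eta1 : forall t, 1 < `|t| -> eta t = 1.
Hypothesis eta0 : forall t, `|t| <= 2^-1 -> eta t = 0.
Variable C : R.
Hypothesis C0 : 0 < C.
Hypothesis dv : forall n : nat, (1 <= n)%N ->
  forall sigma : mi d, (0 < mabs sigma <= m)%N ->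
  forall x, Om x -> `|v x| <= n%:R^-1 -> (2 * n)%:R^-1 < `|v x| ->
  `|dpart sigma v x| <= C * powR n%:R (s sigma - 1).
Variables (f : Rd -> R) (G : mi d -> Rd -> R).
Hypothesis Lf : Lpw Om p (wsv s v (mi0 d)) f.
Hypothesis HG : forall a : mi d, (0 < mabs a <= m)%N ->
  wderiv_v Om (wsv s v (mi0 d)) v a f (G a) /\ Lpw Om p (wsv s v a) (G a).

Let mOm : measurable (Om : set bT) := borel_open oOm.
Local Notation Om' := (nonzero_set Om v).
Local Notation chi := (cutoff v eta).
Local Notation g := (withf f G).

Let mv : measurable_fun (Om : set bT) v := Ck_measurable oOm Cv.

Lemma measurable_wsv (a : mi d) : measurable_fun (Om : set bT) (wsv s v a).
Proof. by apply: (measurableT_comp (measurable_powR _)); exact: measurableT_comp. Qed.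

Lemma wsv_mi0 x : wsv s v (mi0 d) x = `|v x|.
Proof. by rewrite /wsv (admissible0 adm) add0r powRr1. Qed.

Lemma withfP (a : mi d) : (mabs a <= m)%N -> measurable_fun (Om : set bT) (g a) /\
  mu.-integrable Om (fun x => (powR `|g a x * wsv s v a x| p)%:E).
Proof.
move=> am; have Lga : Lpw Om p (wsv s v a) (g a).
  rewrite /withf; case: eqVneq => [->//|a0]; apply: (HG _).2; rewrite am andbT lt0n.
  by apply: contra a0 => /eqP /mabs0 ->.
have [mg ig] := (LpwP muE p (g a) mOm (measurable_wsv a)).1 Lga.
split => //; apply/integrableP; split.
  by apply/measurable_EFinP; apply: measurable_powR_norm => //; exact: measurable_wsv.
under eq_integral do rewrite abse_EFin (ger0_norm (powR_ge0 _ _)).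
exact: ig.
Qed.

(** Local integrability of [f] is a clause of [wderiv_v]; for [a = 0] it is read off a weak
    derivative of some nonzero order [b], which avoids Hölder's inequality. *)
Lemma withf_loc (b a : mi d) : (0 < mabs b <= m)%N -> (mabs a <= m)%N ->
  forall K : set Rd, compact K -> K `<=` Om ->
  mu.-integrable K (fun x => (g a x * v x ^+ (mabs a).+1)%:E).
Proof.
move=> bm am K cK KOm; rewrite /withf; case: eqVneq => [->|a0]; last first.
  have am' : (0 < mabs a <= m)%N.
    by rewrite am andbT lt0n; apply: contra a0 => /eqP /mabs0 ->.
  have [[_ [loc _]] _] := HG am'.
  have mvk : measurable_fun (Om : set bT) (fun x => v x ^+ (mabs a).+1).
    exact: measurable_funX.
  by have [_ h] := (Lpw_locP muE (G a) mOm mvk).1 loc; exact: h.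
have [[loc _] _] := HG bm.
have [mf h] := (Lpw_locP muE f mOm (measurable_wsv (mi0 d))).1 loc.
rewrite mabs_mi0; apply: le_integrable (h K cK KOm); first exact: borel_compact.
  apply/measurable_EFinP; apply: (measurable_funS mOm KOm).
  by apply: measurable_funM => //; exact: measurable_funX.
by move=> x _; rewrite !abse_EFin lee_fin wsv_mi0 expr1 !normrM normr_id.
Qed.

Lemma withf_loc0 (b a : mi d) : (0 < mabs b <= m)%N -> (mabs a <= m)%N ->
  forall K : set Rd, compact K -> K `<=` Om' ->
  mu.-integrable K (fun x => (g a x)%:E).
Proof.
move=> bm am K cK KOm'; apply: (integrable_off_zeros oOm Cv am cK KOm').
by apply: (withf_loc bm am cK); exact: subset_trans KOm' (@nonzero_subset _ _ _ _).
Qed.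

Lemma withf_mi0 : g (mi0 d) = f.
Proof. by rewrite /withf eqxx. Qed.

Lemma withf_identity (b a : mi d) (A : set Rd) (xi : Rd -> R) :
  (0 < mabs b <= m)%N -> (mabs a <= m)%N -> compact A -> A `<=` Om' ->
  Ck setT (mabs a) xi -> (forall x, ~ A x -> xi x = 0) ->
  [/\ mu.-integrable Om (fun x => (f x * dpart a xi x)%:E),
      mu.-integrable Om (fun x => (g a x * xi x)%:E) &
      (\int[mu]_(x in Om) (f x * dpart a xi x)%:E =
       ((-1) ^+ mabs a)%:E * \int[mu]_(x in Om) (g a x * xi x)%:E)%E].
Proof.
move=> bm am; have m0 : (mabs (mi0 d) <= m)%N by rewrite mabs_mi0.
apply: (weak_identity_Ck muE oOm Cv seta eta01 eta1 eta0 am).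
- by rewrite -withf_mi0; have [] := withfP m0.
- by have [] := withfP am.
- by move=> K cK KO; rewrite -withf_mi0; exact: (withf_loc0 bm m0 cK KO).
- exact: (withf_loc0 bm am).
- move=> phi tphi; rewrite /withf; case: eqVneq => [->|a0].
    rewrite mabs_mi0 expr0 mul1e /dpart; congr (intO Om _); apply/funext => x.
    have -> : mseq (mi0 d) = [::] by apply: size0nil; rewrite size_mseq mabs_mi0.
    by rewrite /= mulrC.
  have am' : (0 < mabs a <= m)%N.
    by rewrite am andbT lt0n; apply: contra a0 => /eqP /mabs0 ->.
  by have [[_ [_ h]] _] := HG am'; exact: h.
Qed.

(** The number of splittings with a given pair of multi-indices is the binomial coefficient of
    Leibniz' rule. *)
Definition cutoff_deriv n (a : mi d) (x : Rd) : R :=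
  \sum_(P <- splits (mseq a)) dlist P.1 (chi n) x * g (mi_word P.2) x.

Lemma cutoff_deriv_mi0 n x : cutoff_deriv n (mi0 d) x = chi n x * f x.
Proof.
rewrite /cutoff_deriv.
have -> : mseq (mi0 d) = [::] by apply: size0nil; rewrite size_mseq mabs_mi0.
by rewrite big_seq1 /= mi_word_nil withf_mi0.
Qed.

Lemma splits_mseq (a : mi d) P : (mabs a <= m)%N -> P \in splits (mseq a) ->
  [/\ (size P.1 <= m)%N, (mabs (mi_word P.2) <= m)%N,
      (size P.1 + mabs (mi_word P.2))%N = mabs a &
      s (mi_word P.1) + s (mi_word P.2) <= s a].
Proof.
move=> am Pa; have sP := size_splits Pa; rewrite size_mseq in sP.
rewrite mabs_mi_word; split => //.
- by rewrite (leq_trans _ am)// -sP leq_addr.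
- by rewrite (leq_trans _ am)// -sP leq_addl.
- rewrite -(mi_word_mseq a) -(perm_mi_word (perm_splits Pa)).
  by apply: (admissible_cat adm); rewrite sP.
Qed.

Let Cchi n : Ck Om m (chi n) := Ck_cutoff oOm Cv seta n.

Lemma measurable_cutoff_deriv n (a : mi d) : (mabs a <= m)%N ->
  measurable_fun (Om : set bT) (cutoff_deriv n a).
Proof.
move=> am; apply: measurable_sum_seq => P /(splits_mseq am)[P1 P2 _ _].
apply: measurable_funM; first exact: (dlist_measurable oOm P1 (Cchi n)).
by have [] := withfP P2.
Qed.

(** The inverted Leibniz rule spreads the derivatives of [psi] over the functions [xi P]. These are
    supported in [B], off the zeros of [v], so [withf_identity] applies to each of them, and the sum
    reassembles into [cutoff_deriv]. *)
Lemma cutoff_identity (b : mi d) n (a : mi d) (A : set Rd) (psi : Rd -> R) : (1 <= n)%N ->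
  (0 < mabs b <= m)%N -> (mabs a <= m)%N -> compact A -> A `<=` Om ->
  Ck setT (mabs a) psi -> (forall x, ~ A x -> psi x = 0) ->
  (\int[mu]_(x in Om) (chi n x * f x * dpart a psi x)%:E =
   ((-1) ^+ mabs a)%:E * \int[mu]_(x in Om) (psi x * cutoff_deriv n a x)%:E)%E.
Proof.
move=> n1 bm am cA AOm Cpsi psi0.
pose w := mseq a; have wa : size w = mabs a by exact: size_mseq.
have CpsiOm : Ck Om (mabs a) psi by exact: (Ck_subset (@subsetT _ _) Cpsi).
have c0 : 0 < (2 * n)%:R^-1 :> R by rewrite invr_gt0 ltr0n muln_gt0.
pose B := A `&` [set x | (2 * n)%:R^-1 <= `|v x|].
have oS : open (Om `&` [set x | `|v x| < (2 * n)%:R^-1]).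
  rewrite openE => x [Omx vx]; apply: filterI; first exact: open_nbhs_nbhs.
  have cvx : v @ x --> v x := Ck_cont Cv Omx.
  by apply: (cvx [set t | `|t| < (2 * n)%:R^-1]); apply: open_nbhs_nbhs; split => //; exact: open_norm_lt.
have clA : closed A by apply: compact_closed => //; exact: norm_hausdorff.
(* [v] is continuous on [Om] only, so closedness is read off the complement: either outside [A], or
   in [Om] with small |v|. *)
have clB : closed B.
  rewrite -(setCK B); apply: open_closedC.
  rewrite (_ : ~` B = ~` A `|` (Om `&` [set x | `|v x| < (2 * n)%:R^-1])).
    by apply: openU => //; exact: closed_openC.
  apply/seteqP; split => x; rewrite /B /=.
    move=> nB; have [Ax|] := pselect (A x); [right|by left].
    split; first exact: AOm.
    by rewrite ltNge; apply/negP => h; exact: nB.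
  by move=> [nA [/nA]//|[_ h1] [_ h2]]; move: h1; rewrite ltNge h2.
have cB : compact B by apply: (subclosed_compact clB cA) => x [].
have BOm' : B `<=` Om'.
  move=> x [Ax vx]; split; first exact: AOm.
  by rewrite -normr_gt0 (lt_le_trans c0).
have BOm : B `<=` Om by move=> x [/AOm].
pose xi (P : seq 'I_d * seq 'I_d) x := dlist P.1 (chi n) x * psi x.
have xi0 P : P \in splits w -> forall x, ~ B x -> xi P x = 0.
  move=> /(splits_mseq am)[P1 _ _ _] x nB; rewrite /xi.
  have [Ax|/psi0 ->] := pselect (A x); last by rewrite mulr0.
  rewrite (dlist_cutoff_in oOm Cv seta eta0 n1 P1 (AOm _ Ax)) ?mul0r//.
  by rewrite leNgt; apply/negP => h; apply: nB; split => //=; exact: ltW.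
have Cxi P : P \in splits w -> Ck setT (mabs (mi_word P.2)) (xi P).
  move=> Pw; have [P1 P2 P12 _] := splits_mseq am Pw.
  apply: (Ck_setT oOm clB BOm _ (xi0 P Pw)); apply: (CkM oOm).
    by apply: Ck_dlist; rewrite P12; exact: (Ck_le am (Cchi n)).
  by apply: (Ck_le _ CpsiOm); rewrite -P12 leq_addl.
have xiP P (Pw : P \in splits w) := withf_identity bm
  (let: And4 _ h _ _ := splits_mseq am Pw in h) cB BOm' (Cxi P Pw) (xi0 P Pw).
have dxi P x : P \in splits w -> dlist P.2 (xi P) x = dpart (mi_word P.2) (xi P) x.
  move=> Pw; apply: (dlist_dpart openT _ (I : setT x)).
  by rewrite -mabs_mi_word; exact: Cxi.
pose F (P : seq 'I_d * seq 'I_d) x := (-1) ^+ size P.1 * (f x * dpart (mi_word P.2) (xi P) x).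
pose F' (P : seq 'I_d * seq 'I_d) x := (-1) ^+ mabs a * (g (mi_word P.2) x * xi P x).
have iF P : P \in splits w -> mu.-integrable Om (fun x => (F P x)%:E).
  by move=> Pw; have [h _ _] := xiP P Pw; have := integrableZl mOm ((-1) ^+ size P.1) h.
have iF' P : P \in splits w -> mu.-integrable Om (fun x => (F' P x)%:E).
  by move=> Pw; have [_ h _] := xiP P Pw; have := integrableZl mOm ((-1) ^+ mabs a) h.
(* The signs of the inverted Leibniz rule and of the weak identity multiply to [(-1) ^+ mabs a], the
   same for all [P]. *)
have FF' P : P \in splits w ->
    (\int[mu]_(x in Om) (F P x)%:E = \int[mu]_(x in Om) (F' P x)%:E)%E.
  move=> Pw; have [i1 i2 E] := xiP P Pw; have [_ _ P12 _] := splits_mseq am Pw.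
  have := integralZl mOm i1 ((-1) ^+ size P.1); rewrite E muleA -EFinM -exprD P12.
  by rewrite -(integralZl mOm i2).
transitivity (\int[mu]_(x in Om) (\sum_(P <- splits w) F P x)%:E)%E.
  apply: eq_integral => x /set_mem Omx; congr (_%:E).
  rewrite mulrAC mulrC.
  have h := @dlistM_inv _ _ Om w (chi n) psi x oOm; rewrite wa in h.
  rewrite [dpart a psi x]/(dlist w psi x) (h (Ck_le am (Cchi n)) CpsiOm Omx) mulr_sumr.
  rewrite big_seq [RHS]big_seq; apply: eq_bigr => P Pw.
  by rewrite /F -dxi// mulrCA.
have [_ ->] := integral_sum_seq mOm iF.
rewrite big_seq (eq_bigr _ FF') -big_seq.
have [i1 <-] := integral_sum_seq mOm iF'.
have sgn2 : (-1) ^+ mabs a * (-1) ^+ mabs a = 1 :> R by rewrite -expr2 sqrr_sign.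
have iH : mu.-integrable Om (fun x => (psi x * cutoff_deriv n a x)%:E).
  have := integrableZl mOm ((-1) ^+ mabs a) i1; apply: eq_integrable => // x _.
  rewrite -EFinM; congr (_%:E); rewrite /cutoff_deriv !mulr_sumr; apply: eq_bigr => P _.
  by rewrite /F' (mulrA ((-1) ^+ mabs a)) sgn2 mul1r /xi; ring.
rewrite -(integralZl mOm iH); apply: eq_integral => x _; rewrite -EFinM; congr (_%:E).
rewrite /cutoff_deriv !mulr_sumr; apply: eq_bigr => P _.
by rewrite /F' /xi; ring.
Qed.

(** The left side vanishes unless |v| > 1/(2n), where [powR |v| t] has a positive lower bound; [M]
    may depend on [n]. *)
Lemma dlist_cutoff_le_powR n w t : (1 <= n)%N -> (size w <= m)%N -> 0 <= t ->
  exists2 M, 0 <= M & forall x, Om x -> `|dlist w (chi n) x| <= M * powR `|v x| t.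
Proof.
move=> n1 wm t0.
have [D D0 HD] := dlist_cutoff_bound oOm Cv adm seta eta01 eta1 eta0 C0 dv wm.
have c0 : 0 < (2 * n)%:R^-1 :> R by rewrite invr_gt0 ltr0n muln_gt0.
have ct : 0 < powR ((2 * n)%:R^-1 : R) t by rewrite powR_gt0.
have M0 : 0 <= D * powR n%:R (s (mi_word w)) by rewrite mulr_ge0 ?powR_ge0.
exists (D * powR n%:R (s (mi_word w)) / powR (2 * n)%:R^-1 t).
  by rewrite divr_ge0// ltW.
move=> x Omx; have [vx|vx] := leP `|v x| (2 * n)%:R^-1.
  rewrite (dlist_cutoff_in oOm Cv seta eta0 n1 wm Omx vx) normr0.
  by rewrite mulr_ge0 ?powR_ge0// divr_ge0// ltW.
rewrite (le_trans (HD n x n1 Omx))// -mulrA ler_peMr// ler_pdivlMl// mulr1.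
by apply: ge0_ler_powR; rewrite ?nnegrE// ltW.
Qed.

(** In contrast with [dlist_cutoff_le_powR], [K] is uniform in [n]: the growth [n^(s P.1)] is paid
    for by the excess of the weight of order [a] over that of order [P.2]. *)
Lemma cutoff_wsv_bound (a : mi d) P : (mabs a <= m)%N -> P \in splits (mseq a) ->
  exists2 K, 0 <= K & forall n x, (1 <= n)%N -> Om x ->
    `|dlist P.1 (chi n) x| * wsv s v a x <= K * wsv s v (mi_word P.2) x.
Proof.
move=> am Pa; have [P1 P2 P12 sP] := splits_mseq am Pa.
have [P0|P0] := eqVneq P.1 [::].
  have Ea : mi_word P.2 = a.
    by have := perm_mi_word (perm_splits Pa); rewrite P0 mi_word_mseq.
  exists 1 => // n x n1 Omx; rewrite P0 Ea ler_wpM2r ?powR_ge0//=.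
  by have /andP[e0 e1] := eta01 (n%:R * v x); rewrite ger0_norm.
have [D D0 HD] := dlist_cutoff_bound oOm Cv adm seta eta01 eta1 eta0 C0 dv P1.
exists D => // n x n1 Omx.
have n0 : 0 < n%:R :> R by rewrite ltr0n.
have w0 b : 0 <= wsv s v b x by exact: powR_ge0.
have [vx|vx] := ltP n%:R^-1 `|v x|.
  by rewrite (dlist_cutoff_out oOm Cv seta eta1 n1 P1 P0 Omx vx) normr0 mul0r mulr_ge0.
have [vx2|vx2] := leP `|v x| (2 * n)%:R^-1.
  by rewrite (dlist_cutoff_in oOm Cv seta eta0 n1 P1 Omx vx2) normr0 mul0r mulr_ge0.
have v0 : 0 < `|v x| by rewrite (lt_trans _ vx2)// invr_gt0 ltr0n muln_gt0.
have v1 : `|v x| <= 1 by rewrite (le_trans vx)// invf_le1// ler1n.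
have s1 : 0 <= s (mi_word P.1) by apply: (admissible_ge0 adm); rewrite mabs_mi_word.
rewrite (le_trans (ler_wpM2r (w0 a) (HD n x n1 Omx)))// -mulrA ler_wpM2l//.
have wa : wsv s v a x <= powR `|v x| (s (mi_word P.1)) * wsv s v (mi_word P.2) x.
  rewrite /wsv -powRD; last by rewrite (gt_eqF v0) implybT.
  by rewrite ger_powR ?v0// addrA lerD2r.
(* What remains is [(n |v x|)^(s P.1) <= 1]. *)
rewrite (le_trans (ler_wpM2l (powR_ge0 _ _) wa))// mulrA ler_piMl//.
have one : powR (1 : R) (s (mi_word P.1)) = 1 by rewrite powR1.
rewrite -powRM ?(ltW n0)// -[leRHS]one.
apply: ge0_ler_powR; rewrite ?nnegrE ?mulr_ge0// ?(ltW n0)//.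
by rewrite mulrC -ler_pdivlMr// mul1r.
Qed.

(** With exponent [|P.2| + 1], the bound on the cut-off supplies exactly the power of [v] against
    which the weak derivative of order [P.2] is locally integrable. *)
Lemma cutoff_deriv_loc (b : mi d) n (a : mi d) : (1 <= n)%N -> (0 < mabs b <= m)%N ->
  (mabs a <= m)%N -> forall K : set Rd, compact K -> K `<=` Om ->
  mu.-integrable K (fun x => (cutoff_deriv n a x)%:E).
Proof.
move=> n1 bm am K cK KOm; have mK := borel_compact cK.
apply: (integral_sum_seq mK _).1 => P /(splits_mseq am)[P1 P2 _ _].
set k := (mabs (mi_word P.2)).+1.
have [M M0 HM] := dlist_cutoff_le_powR n1 P1 (ler0n R k).
apply: le_integrable (integrableZl mK M (withf_loc bm P2 cK KOm)) => //.
  apply/measurable_EFinP; apply: (measurable_funS mOm KOm).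
  apply: measurable_funM; first exact: (dlist_measurable oOm P1 (Cchi n)).
  by have [] := withfP P2.
move=> x Kx; rewrite -EFinM !abse_EFin lee_fin -/k.
have := HM x (KOm x Kx); rewrite powR_mulrn// => h.
rewrite !normrM normrX (ger0_norm M0) [leLHS]mulrC [leRHS]mulrCA ler_wpM2l//.
Qed.

Lemma Lpw_le (u h Q : bT -> R) : measurable_fun (Om : set bT) u ->
  measurable_fun (Om : set bT) h -> mu.-integrable Om (fun x => (Q x)%:E) ->
  (forall x, Om x -> powR `|h x * u x| p <= Q x) -> Lpw Om p u h.
Proof.
move=> mu' mh iQ hQ; apply/(LpwP muE p h mOm mu'); split => //.
have /integrableP[mQ] := iQ; apply: le_lt_trans.
apply: ge0_le_integral => //.
- by apply/measurable_EFinP; exact: measurable_powR_norm.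
- exact: measurableT_comp.
- by move=> x Omx; rewrite abse_EFin lee_fin (le_trans (hQ x Omx))// ler_norm.
Qed.

(** [Q] depends on the constants [k] but not on the coefficients [c], so bounds uniform in [n] give
    one dominating function for all [n]. *)
Lemma combination_dominated (a : mi d) (k : seq 'I_d * seq 'I_d -> R) :
  (mabs a <= m)%N -> (forall P, 0 <= k P) ->
  exists Q : bT -> R, mu.-integrable Om (fun x => (Q x)%:E) /\
    forall (c : seq 'I_d * seq 'I_d -> R) (u : R) x,
      (forall P, P \in splits (mseq a) -> `|c P| * u <= k P * wsv s v (mi_word P.2) x) ->
      0 <= u ->
      powR `|(\sum_(P <- splits (mseq a)) c P * g (mi_word P.2) x) * u| p <= Q x.
Proof.
move=> am k0.
pose q (P : seq 'I_d * seq 'I_d) x := g (mi_word P.2) x * wsv s v (mi_word P.2) x.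
have iq P : P \in splits (mseq a) -> mu.-integrable Om (fun x => (powR `|q P x| p)%:E).
  by move=> /(splits_mseq am)[_ P2 _ _]; have [] := withfP P2.
have [Q [iQ HQ]] := Lp_dominated p1 mOm k0 iq.
exists Q; split => // c u x cu u0; apply: HQ.
rewrite normrM (ger0_norm u0) (le_trans (ler_wpM2r u0 (ler_norm_sum _ _ _)))//.
rewrite mulr_suml big_seq [leRHS]big_seq; apply: ler_sum => P Pa.
rewrite normrM mulrAC (le_trans (ler_wpM2r (normr_ge0 _) (cu P Pa)))//.
rewrite /q normrM (ger0_norm (powR_ge0 _ _)) -mulrA.
by rewrite [_ * `|g _ x|]mulrC.
Qed.

Lemma cutoff_deriv_Lp n (a : mi d) : (1 <= n)%N -> (mabs a <= m)%N ->
  Lpw Om p (fun=> 1) (cutoff_deriv n a) /\ Lpw Om p (wsv s v a) (cutoff_deriv n a).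
Proof.
move=> n1 am; split.
  have /choice[k kP] (P : seq 'I_d * seq 'I_d) : exists M, 0 <= M /\
      (P \in splits (mseq a) -> forall x, Om x ->
        `|dlist P.1 (chi n) x| <= M * wsv s v (mi_word P.2) x).
    have [Pa|_] := boolP (P \in splits (mseq a)); last by exists 0.
    have [P1 P2 _ _] := splits_mseq am Pa.
    have sP2 : 0 <= s (mi_word P.2) + 1 by rewrite addr_ge0// (admissible_ge0 adm).
    by have [M M0 HM] := dlist_cutoff_le_powR n1 P1 sP2; exists M.
  have [Q [iQ HQ]] := combination_dominated am (fun P => (kP P).1).
  apply: (Lpw_le _ (measurable_cutoff_deriv n am) iQ); first exact: measurable_cst.
  move=> x Omx; apply: (HQ (fun P => dlist P.1 (chi n) x) 1) => // P Pa.
  by rewrite mulr1; exact: (kP P).2.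
have /choice[k kP] (P : seq 'I_d * seq 'I_d) : exists M, 0 <= M /\
    (P \in splits (mseq a) -> forall n x, (1 <= n)%N -> Om x ->
      `|dlist P.1 (chi n) x| * wsv s v a x <= M * wsv s v (mi_word P.2) x).
  have [Pa|_] := boolP (P \in splits (mseq a)); last by exists 0.
  by have [M M0 HM] := cutoff_wsv_bound am Pa; exists M.
have [Q [iQ HQ]] := combination_dominated am (fun P => (kP P).1).
apply: (Lpw_le (measurable_wsv a) (measurable_cutoff_deriv n am) iQ) => x Omx.
apply: (HQ (fun P => dlist P.1 (chi n) x)); last exact: powR_ge0.
by move=> P Pa; apply: (kP P).2.
Qed.

(** Subtracting [g a] only turns the coefficient chi of the splitting with empty first half into chi
    - 1. *)
Lemma cutoff_deriv_diff n (a : mi d) x : cutoff_deriv n a x - g a x =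
  \sum_(P <- splits (mseq a))
    (dlist P.1 (chi n) x - (P.1 == [::])%:R) * g (mi_word P.2) x.
Proof.
have := sum_splits_nil (mseq a) (fun u => g (mi_word u) x); rewrite mi_word_mseq => <-.
rewrite /cutoff_deriv -sumrB; apply: eq_bigr => P _.
by case: (P.1 == [::]); rewrite /= ?subr0 ?mulrBl ?mul1r.
Qed.

Lemma cutoff_deriv_cvg (a : mi d) : (mabs a <= m)%N ->
  (fun n => \int[mu]_(x in Om)
     (powR `|(cutoff_deriv n.+1 a x - g a x) * wsv s v a x| p)%:E)%E @ \oo --> 0%E.
Proof.
move=> am; have p0 : p != 0 by rewrite gt_eqF// (lt_le_trans _ p1).
have /choice[k kP] (P : seq 'I_d * seq 'I_d) : exists M, 0 <= M /\
    (P \in splits (mseq a) -> forall n x, (1 <= n)%N -> Om x ->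
      `|dlist P.1 (chi n) x - (P.1 == [::])%:R| * wsv s v a x
      <= M * wsv s v (mi_word P.2) x).
  have [Pa|_] := boolP (P \in splits (mseq a)); last by exists 0.
  have [M M0 HM] := cutoff_wsv_bound am Pa.
  (* The extra 1 bounds the subtracted term, whose splitting has [P.2] of multi-index [a]. *)
  exists (M + 1); split => [|_ n x n1 Omx]; first exact: addr_ge0.
  rewrite (le_trans (ler_wpM2r (powR_ge0 _ _) (ler_normB _ _)))// mulrDl mulrDl.
  rewrite lerD ?HM// normr_nat; have [P0|_] := eqVneq P.1 [::].
    by have := perm_mi_word (perm_splits Pa); rewrite P0 mi_word_mseq => <-.
  by rewrite /= mul0r mul1r powR_ge0.
have [Q [iQ HQ]] := combination_dominated am (fun P => (kP P).1).
have [mga _] := withfP am.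
have mF n : measurable_fun (Om : set bT)
    (fun x => powR `|(cutoff_deriv n.+1 a x - g a x) * wsv s v a x| p).
  apply: measurable_powR_norm; last exact: measurable_wsv.
  by apply: measurable_funB => //; exact: measurable_cutoff_deriv.
have lim0 x : Om x -> (fun n => powR `|(cutoff_deriv n.+1 a x - g a x) * wsv s v a x| p)
    @ \oo --> (0 : R).
  (* At a zero of [v] the weight itself is 0, its exponent being at least 1. Elsewhere the sequence
     is eventually 0: once [1/(n+1) < |v x|], the cut-off is 1 and its derivatives vanish. *)
  move=> Omx; apply: cvg_near_cst; have [v0|v0] := eqVneq (v x) 0.
    apply: nearW => n; rewrite /wsv v0 normr0 [powR 0 (_ + _)]powR0 ?mulr0 ?normr0 ?powR0//.
    by rewrite gt_eqF// ltr_wpDl// (admissible_ge0 adm).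
  have v_gt0 : 0 < `|v x| by rewrite normr_gt0.
  near=> n.
  have nv : n.+1%:R^-1 < `|v x| by near: n; exact: (near_infty_natSinv_lt (PosNum v_gt0)).
  rewrite cutoff_deriv_diff big_seq big1 ?mul0r ?normr0 ?powR0// => P Pa.
  have [P1 _ _ _] := splits_mseq am Pa.
  have [P0|P0] := eqVneq P.1 [::]; last first.
    by rewrite (dlist_cutoff_out oOm Cv seta eta1 _ P1 P0 Omx nv)// subr0 mul0r.
  rewrite P0 /= /cutoff eta1 ?subrr ?mul0r//.
  by rewrite normrM ger0_norm// -ltr_pdivrMl// mulr1.
have [] := @dominated_convergence _ _ _ mu Om mOm
  (fun n x => (powR `|(cutoff_deriv n.+1 a x - g a x) * wsv s v a x| p)%:E)
  (fun=> 0%E) (fun x => (Q x)%:E).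
- by move=> n; apply/measurable_EFinP; exact: mF.
- exact: measurable_cst.
- by apply/aeW => x Omx; apply/cvg_EFin; [exact: nearW|exact: lim0].
- exact: iQ.
- apply/aeW => x n Omx; rewrite abse_EFin lee_fin ger0_norm ?powR_ge0//.
  rewrite cutoff_deriv_diff.
  apply: (HQ (fun P => dlist P.1 (chi n.+1) x - (P.1 == [::])%:R)); last exact: powR_ge0.
  by move=> P Pa; apply: (kP P).2.
by move=> _ _; rewrite integral0.
Unshelve. all: by end_near. Qed.

Lemma measurable_cutoff_mul n : measurable_fun (Om : set bT) (fun x => chi n x * f x).
Proof.
apply: measurable_funM; first exact: (Ck_measurable oOm (Cchi n)).
by rewrite -withf_mi0; have [] : _ := @withfP (mi0 d) _; rewrite ?mabs_mi0.
Qed.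

Lemma integrable_mult_cont (K : set Rd) (q c : Rd -> R) : compact K -> K `<=` Om ->
  (forall x, Om x -> {for x, continuous c}) -> mu.-integrable K (fun x => (q x)%:E) ->
  mu.-integrable K (fun x => (q x * c x)%:E).
Proof.
move=> cK KOm cc iq.
have [M _ HM] := compact_cont_bounded cK (fun x Kx => cc x (KOm x Kx)).
apply: (integrable_mult_bounded (borel_compact cK) _ HM iq).
by apply: (measurable_funS mOm KOm); exact: measurable_cont.
Qed.

(** [cutoff_identity] with [psi = v^(|a|+1) phi], which vanishes outside the support of [phi] and is
    therefore of class C^|a| on the whole space. *)
Lemma wderiv_v_cutoff n (a : mi d) : (1 <= n)%N -> (0 < mabs a <= m)%N ->
  wderiv_v Om (wsv s v (mi0 d)) v a (fun x => chi n x * f x) (cutoff_deriv n a).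
Proof.
move=> n1 am; have /andP[_ am'] := am.
have CV : Ck Om (mabs a) (fun x => v x ^+ (mabs a).+1).
  exact: (CkX _ oOm (Ck_le am' Cv)).
have mV := Ck_measurable oOm CV.
split; [|split].
- apply/(Lpw_locP muE _ mOm (measurable_wsv _)); split; first exact: measurable_cutoff_mul.
  move=> K cK KOm; have [[loc _] _] := HG am.
  have [_ h] := (Lpw_locP muE f mOm (measurable_wsv _)).1 loc.
  have := integrable_mult_cont cK KOm (fun x Ox => Ck_cont (Cchi n) Ox) (h K cK KOm).
  apply: eq_integrable; first exact: borel_compact.
  by move=> x _; congr (_%:E); ring.
- apply/(Lpw_locP muE _ mOm mV); split; first exact: measurable_cutoff_deriv.
  move=> K cK KOm; apply: (integrable_mult_cont cK KOm (fun x Ox => Ck_cont CV Ox)).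
  exact: (cutoff_deriv_loc n1 am am').
- move=> phi [Cphi [K [cK KOm phi0]]].
  pose psi y := v y ^+ (mabs a).+1 * phi y.
  have psi0 x : ~ K x -> psi x = 0 by move=> Kx; rewrite /psi phi0// mulr0.
  have Cpsi : Ck setT (mabs a) psi.
    apply: (Ck_setT oOm _ KOm _ psi0).
      by apply: compact_closed => //; exact: norm_hausdorff.
    exact: (CkM oOm CV (Ck_subset (@subsetT _ _) (Cphi _))).
  have CpsiOm : Ck Om (mabs a) psi by exact: (Ck_subset (@subsetT _ _) Cpsi).
  have := cutoff_identity n1 am am' cK KOm Cpsi psi0.
  rewrite (intOE muE mOm) ?(intOE muE mOm)//.
    exact: (measurable_funM (Ck_measurable oOm CpsiOm) (measurable_cutoff_deriv n am')).
  apply: (measurable_funM (measurable_cutoff_mul n)).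
  by apply: (dlist_measurable oOm _ CpsiOm); rewrite size_mseq.
Qed.

Lemma wderiv_cutoff n (a : mi d) : (1 <= n)%N -> (0 < mabs a <= m)%N ->
  wderiv Om a (fun x => chi n x * f x) (cutoff_deriv n a).
Proof.
move=> n1 am; have /andP[_ am'] := am.
have m1 : measurable_fun (Om : set bT) (fun=> 1 : R) by exact: measurable_cst.
have m0 : (mabs (mi0 d) <= m)%N by rewrite mabs_mi0.
have loc (b : mi d) : (mabs b <= m)%N -> Lpw_loc Om 1 (fun=> 1) (cutoff_deriv n b).
  move=> bm; apply/(Lpw_locP muE _ mOm m1); split; first exact: measurable_cutoff_deriv.
  move=> K cK KOm; have := cutoff_deriv_loc n1 am bm cK KOm.
  by apply: eq_integrable; [exact: borel_compact|move=> x _; rewrite mulr1].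
split; [|split]; last 1 first.
- move=> phi [Cphi [K [cK KOm phi0]]].
  have CphiOm k : Ck Om k phi by exact: (Ck_subset (@subsetT _ _) (Cphi k)).
  have := cutoff_identity n1 am am' cK KOm (Cphi _) phi0.
  rewrite (intOE muE mOm) ?(intOE muE mOm)//.
    exact: (measurable_funM (Ck_measurable oOm (CphiOm 0%N)) (measurable_cutoff_deriv n am')).
  apply: (measurable_funM (measurable_cutoff_mul n)).
  by apply: (dlist_measurable oOm _ (CphiOm (mabs a))); rewrite size_mseq.
(* Chi f is the Leibniz sum of order zero, so [loc] covers both functions. *)
- have -> : (fun x => chi n x * f x) = cutoff_deriv n (mi0 d).
    by apply/funext => x; rewrite cutoff_deriv_mi0.
  exact: loc.
- exact: loc.
Qed.

End cutoff_products.

(** * Convergence in the weighted Sobolev space *)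

Lemma cvg_sume_seq (R : realType) (I : Type) (r : seq I) (P : pred I) (u : I -> nat -> \bar R) :
  (forall i, P i -> u i @ \oo --> 0%E) ->
  (fun n => \sum_(i <- r | P i) u i n)%E @ \oo --> 0%E.
Proof.
move=> u0; elim: r => [|i r IH].
  by rewrite (_ : (fun _ => _) = cst 0%E); [exact: cvg_cst|apply/funext => n; rewrite big_nil].
rewrite (_ : (fun _ => _) = (fun n => if P i then u i n + \sum_(j <- r | P j) u j n
  else \sum_(j <- r | P j) u j n)%E); last by apply/funext => n; rewrite big_cons.
have [Pi|_] := boolP (P i); last exact: IH.
have def0 : ((0 : \bar R) +? 0)%E by [].
have E : (0 : \bar R) = (0 + 0)%E by rewrite adde0.
rewrite {2}E.
exact: (cvgeD def0 (u0 i Pi) IH).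
Qed.

Theorem theorem8 (R : realType) (d : nat) (Om : set 'rV[R]_d) (p : R)
  (m : nat) (v : 'rV[R]_d -> R) (s : mi d -> R) (eta : R -> R) :
  open Om ->
  1 <= p ->
  Ckstar Om m v ->
  Linfty Om v ->
  admissible m s ->
  (* the fixed cut-off profile eta *)
  (forall (k : nat) (t : R), derivable (iter k (@derive1 R R) eta) t 1) ->
  (forall t, 0 <= eta t <= 1) ->
  (forall t, 1 < `|t| -> eta t = 1) ->
  (forall t, `|t| <= 2^-1 -> eta t = 0) ->
  (* M_n = {x in Om : |v x| <= 1/n} *)
  let M := fun n : nat => [set x | Om x /\ `|v x| <= n%:R^-1] in
  (* chi_n = eta (n v) *)
  let chi := fun (n : nat) (x : 'rV[R]_d) => eta (n%:R * v x) in
  (exists2 C : R, 0 < C &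
     forall n : nat, (1 <= n)%N ->
     forall sigma : mi d, (0 < mabs sigma <= m)%N ->
     forall x, M n x -> ~ M (2 * n)%N x ->
       `|dpart sigma v x| <= C * powR n%:R (s sigma - 1)) ->
  forall f : 'rV[R]_d -> R, Wsv Om m p s v f ->
    (forall n : nat, (1 <= n)%N ->
       Wmp Om m p (fun x => chi n x * f x) /\
       Wsv Om m p s v (fun x => chi n x * f x)) /\
    exists (Gf : mi d -> 'rV[R]_d -> R) (GF : nat -> mi d -> 'rV[R]_d -> R),
      (forall a : mi d, (0 < mabs a <= m)%N ->
         wderiv_v Om (wsv s v (mi0 d)) v a f (Gf a) /\
         forall n : nat,
           wderiv_v Om (wsv s v (mi0 d)) v a
             (fun x => chi n.+1 x * f x) (GF n a)) /\
      (fun n : nat =>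
         Wsv_distp Om m p s v (fun x => chi n.+1 x * f x) f (GF n) Gf)
        @ \oo --> (0%E : \bar R).
Proof.
move=> oOm p1 [Cv _] _ adm seta eta01 eta1 eta0 M chi [C C0 hC] f [Lf HW].
have [mu [_ muE]] := intRd_measure R d.
have dv (n : nat) : (1 <= n)%N -> forall sigma : mi d, (0 < mabs sigma <= m)%N ->
    forall x, Om x -> `|v x| <= n%:R^-1 -> (2 * n)%:R^-1 < `|v x| ->
    `|dpart sigma v x| <= C * powR n%:R (s sigma - 1).
  move=> n1 sigma sm x Omx vx vx2; apply: (hC n n1 sigma sm x); first by split.
  by move=> [_]; rewrite leNgt vx2.
have /choice[G HG] (a : mi d) : exists g, (0 < mabs a <= m)%N ->
    wderiv_v Om (wsv s v (mi0 d)) v a f g /\ Lpw Om p (wsv s v a) g.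
  by have [/HW[g hg]|_] := boolP (0 < mabs a <= m)%N; [exists g|exists (fun=> 0)].
have mOm : measurable (Om : set (borelT R d)) by exact: borel_open.
pose H n a := cutoff_deriv v eta f G n a.
have H0 n : H n (mi0 d) = fun x => chi n x * f x.
  by apply/funext => x; exact: cutoff_deriv_mi0.
have LpH n a (n1 : (1 <= n)%N) := cutoff_deriv_Lp muE oOm p1 Cv adm seta eta01 eta1 eta0
  C0 dv Lf HG n1 (a := a).
have wH n a (n1 : (1 <= n)%N) := wderiv_v_cutoff muE oOm Cv adm seta eta01 eta1 eta0
  C0 dv Lf HG n1 (a := a).
have wH1 n a (n1 : (1 <= n)%N) := wderiv_cutoff muE oOm Cv adm seta eta01 eta1 eta0
  C0 dv Lf HG n1 (a := a).
have m0 : (mabs (mi0 d) <= m)%N by rewrite mabs_mi0.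
split=> [n n1|].
  have [L1 Lw] := LpH n (mi0 d) n1 m0; rewrite -/(H n (mi0 d)) H0 in L1 Lw.
  split; split => // a am; exists (H n a); have /andP[_ am'] := am;
    have [La1 Law] := LpH n a n1 am'; split => //.
    exact: wH1.
  exact: wH.
exists G, (fun n a => H n.+1 a); split.
  by move=> a am; split; [exact: (HG a am).1|move=> n; exact: wH].
rewrite /Wsv_distp /sum_pi; apply: cvg_sume_seq => a am.
have am' := am : (mabs (mi_of a) <= m)%N.
have := cutoff_deriv_cvg muE oOm p1 Cv adm seta eta01 eta1 eta0 C0 dv Lf HG am'.
rewrite (_ : (fun n => intnn _ _) = (fun n => \int[mu]_(x in Om)
    (powR `|(H n.+1 (mi_of a) x - withf f G (mi_of a) x) * wsv s v (mi_of a) x| p)%:E)%E)//.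
apply/funext => n.
(* [withf] overrides the family at order zero, where the Leibniz sum already equals chi f. *)
have -> : withf (fun x => chi n.+1 x * f x) (H n.+1) (mi_of a) = H n.+1 (mi_of a).
  by rewrite {1}/withf; case: eqVneq => [->|//]; rewrite H0.
apply: intnnE => //; apply: measurable_powR_norm; last exact: (measurable_wsv s oOm Cv).
apply: measurable_funB.
  exact: (measurable_cutoff_deriv muE oOm Cv adm seta Lf HG).
by have [] := withfP muE oOm Cv Lf HG am'.
Qed.
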